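(* Let $f:\mathbb{R}^2\to\mathbb{R}$ be a smooth function with bounded critical set and let $\lambda_1\prec\lambda_2\prec\cdots$ be an infinite sequence of simple closed curves such that $d(\lambda_i)\to\infty$. Suppose that each $\lambda_i$ is generic for $f$, i.e. $a_{\lambda_i}(f)$ is a ribbon. Then the limit $$\gamma_\infty(f)=\lim_{i\to\infty}\gamma(a_{\lambda_i}(f))$$ exists and does not depend on the choice of the sequence $\lambda_i$. Furthermore, for any homotopy $f_t$, $t\in[0,1]$, with compact support such that $f_0=f$, we have $\gamma_\infty(f_1)=\gamma_\infty(f)$.
   Context: All functions and curves are $C^\infty$. For simple closed curves in $\mathbb{R}^2$, $\lambda\prec\lambda'$ means that $\lambda$ lies in the interior (bounded complementary region) of $\lambda'$. For a simple closed curve $\lambda$ containing the origin in its interior $W$, $d(\lambda)=\sup\{r:\ B_r\subset W\}$, where $B_r$ is the disk $x^2+y^2\le r$. For a simple closed curve $\lambda$ not meeting the critical set $\mathrm{Crit}(f)$, $a_\lambda(f)$ denotes the data consisting of the restriction $f|_\lambda$ together with, for each critical point $p$ of $f|_\lambda$ (a node), a sign $\nu(p)\in\{-1,+1\}$ defined as follows: $\nu(p)$ is the sign of the derivative of $f$ at $p$ along the outward normal of $\lambda$ if $p$ is a local maximum of $f|_\lambda$, and minus that sign if $p$ is a local minimum. $\lambda$ is generic (and $a_\lambda(f)$ is a ribbon) if $f|_\lambda$ is a Morse function with pairwise distinct critical values. For such $\lambda$ with interior $W$, $\gamma(a_\lambda(f))$ is the minimal number of critical points of $F$, where $F:\overline{W}\to\mathbb{R}$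 runs over all smooth functions with $F|_\lambda=f|_\lambda$ such that at each node $p$ the outward normal derivative of $F$ is nonzero and has the same sign as that of $f$. A homotopy $f_t$ of $f$ has compact support if it is smooth and there is a bounded region $W_0\subset\mathbb{R}^2$ with $f_t(x)=f(x)$ for all $x\in\mathbb{R}^2\setminus W_0$ and $t\in[0,1]$. *)

(* Defs.v *)
From HB Require Import structures.
From mathcomp Require Import all_boot all_order all_algebra.
From mathcomp Require Import all_classical all_reals all_analysis.

Set Implicit Arguments.
Unset Strict Implicit.
Unset Printing Implicit Defensive.

Import Order.TTheory GRing.Theory Num.Theory.
Import numFieldNormedType.Exports.

Local Open Scope classical_set_scope.
Local Open Scope ring_scope.

Definition iter_derive (R : realType) (V W : normedModType R)
    (f : V -> W) (vs : seq V) : V -> W :=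
  foldr (fun v g => fun x => 'D_v g x) f vs.

(* On a finite-dimensional V this is C^oo: every iterated directional
   derivative is everywhere differentiable, hence continuous. *)
Definition smooth (R : realType) (V W : normedModType R) (f : V -> W) : Prop :=
  forall (vs : seq V) (x : V), differentiable (iter_derive f vs) x.

Section Plane.
Context {R : realType}.

(* The library norm on the product is the sup norm, so Euclidean lengths and
   angles go through this inner product. *)
Notation plane := (R * R)%type.

Definition dotp (u v : plane) : R := u.1 * v.1 + u.2 * v.2.

Definition crit (f : plane -> R) : set plane :=
  [set p | forall v : plane, 'D_v f p = 0].

(* A smoothly embedded circle, given by a regular 1-periodic parametrization;
   the curve as a point set is [range c]. *)
Definition simple_closed_curve (c : R -> plane) : Prop :=
  [/\ smooth c,
      forall t, c (t + 1) = c t,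
      {in `[0, 1[ &, injective c} &
      forall t, 'D_1 c t != 0].

(* The union of the bounded components of the complement of the curve, of
   which there is exactly one by the Jordan curve theorem. *)
Definition interior_of (c : R -> plane) : set plane :=
  [set p | ~ range c p /\ bounded_set (connected_component (~` range c) p)].

Definition prec_curve (c c' : R -> plane) : Prop :=
  range c `<=` interior_of c'.

Definition disk (r : R) : set plane := [set p | p.1 ^+ 2 + p.2 ^+ 2 <= r].

Definition dist_curve (c : R -> plane) : R :=
  sup [set r : R | disk r `<=` interior_of c].

Definition outward_normal (c : R -> plane) (t : R) (n : plane) : Prop :=
  [/\ dotp n n = 1, dotp n ('D_1 c t) = 0 &
      (\forall s \near 0^'+, ~ closure (interior_of c) (c t + s *: n))].

(* A node is a parameter in [0, 1[, so that each critical point of the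
   restriction of f to the curve is listed once. *)
Definition node (f : plane -> R) (c : R -> plane) (t : R) : Prop :=
  (t \in `[0, 1[) /\ derive1 (f \o c) t = 0.

Definition generic (f : plane -> R) (c : R -> plane) : Prop :=
  [/\ range c `&` crit f = set0,
      (forall t, node f c t -> derive1n 2 (f \o c) t != 0) &
      forall s t, node f c s -> node f c t -> s != t -> f (c s) != f (c t)].

(* The functions F competing in the definition of gamma. A smooth function on
   the closed region is represented by a smooth extension to the plane. Only
   its values on the region matter: the region is the closure of its interior,
   so they determine the derivatives of F there. *)
Definition extends_ribbon (f : plane -> R) (c : R -> plane)
    (F : plane -> R) : Prop :=
  [/\ smooth F,
      forall t, F (c t) = f (c t) &
      forall t n, node f c t -> outward_normal c t n ->
        'D_n F (c t) != 0 /\ Num.sg ('D_n F (c t)) = Num.sg ('D_n f (c t))].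

(* gamma (a_c (f)): the infimum is a minimum, because the counts lie in
   nat + {+oo} and f itself extends its ribbon. *)
Definition gamma (f : plane -> R) (c : R -> plane) : \bar R :=
  ereal_inf [set counting (closure (interior_of c) `&` crit F)
            | F in [set F | extends_ribbon f c F]].

(* The origin is required to be inside each curve because dist_curve is
   meaningful only for such curves. *)
Definition exhausting (f : plane -> R) (lam : nat -> R -> plane) : Prop :=
  [/\ forall i, simple_closed_curve (lam i),
      forall i, prec_curve (lam i) (lam i.+1),
      forall i, interior_of (lam i) (0, 0),
      dist_curve (lam i) @[i --> \oo] --> +oo &
      forall i, generic f (lam i)].

(* gamma_oo (f) exists, is independent of the sequence, and equals n. The
   first clause makes n unique. *)
Definition gamma_infty_is (f : plane -> R) (n : nat) : Prop :=
  (exists lam, exhausting f lam) /\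
  (forall lam, exhausting f lam ->
     gamma f (lam i) @[i --> \oo] --> (n%:R)%:E).

(* A homotopy smooth on [0, 1] x plane is represented by a smooth extension
   to R x plane; only its values for t in [0, 1] are constrained. *)
Definition compact_homotopy (f : plane -> R) (h : R * plane -> R) : Prop :=
  [/\ smooth h,
      forall x, h (0, x) = f x &
      exists W0 : set plane, bounded_set W0 /\
        forall t x, t \in `[0, 1] -> ~ W0 x -> h (t, x) = f x].

End Plane.

(* Main.v *)
(* If F extends the ribbon of f along c, glue F inside c with f outside c. Along
   c the functions f and F ascend in a common direction: the tangent away from
   the nodes, the outward normal at a node. Hence no convex combination of the
   two gradients vanishes near c, and the gluing
   G = f + chi u + (1 - chi) phi(u), u = F - f, with chi a cutoff away from c and
   phi a smooth threshold, creates no critical point. If the critical points of f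
   lie inside c, which lies inside c', this gives
   gamma (a_c' (f)) <= gamma (a_c (f)). These numbers are finite: subtracting a
   small linear function, cut off near c, makes the critical set a fiber of the
   gradient of f, and a Lipschitz map of the plane has finite fibers over almost
   all values. Interlacing two exhausting sequences then shows that gamma is
   eventually constant, with the same value for both sequences. A compactly
   supported homotopy does not change f near the curves far out.

   Of the Jordan curve theorem only the existence of outward normals is used. *)

Require Import Defs.
From HB Require Import structures.
From mathcomp Require Import all_boot all_order all_algebra.
From mathcomp Require Import finmap.
From mathcomp Require Import all_classical all_reals all_analysis.
From mathcomp Require Import measurable_realfun.
From mathcomp Require Import ring lra.

Set Implicit Arguments.
Unset Strict Implicit.
Unset Printing Implicit Defensive.

Import Order.TTheory GRing.Theory Num.Theory.
Import numFieldNormedType.Exports.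

Local Open Scope classical_set_scope.
Local Open Scope ring_scope.

(** * Smooth maps *)

(** On the curve [F] and [f] agree in value and, at the nodes, in the sign of one derivative;
    nothing matches their first derivatives. With a plain cutoff [f + chi u] the obstacle is the
    term [u grad chi]: where [chi] climbs from 0 to 1 in a thin collar, [u] is of the order of the
    width and [grad chi] of its inverse, so the product need not be small. Adding [(1 - chi) phi(u)]
    replaces [u] by [u - phi(u)] in this term. Here [chi] is fixed beforehand, and [phi] is then
    taken so close to the identity that the common ascent dominates the term. As [phi] vanishes near
    0, [G] equals [f] on a whole neighbourhood of the curve, which gives smoothness across it.

    Finiteness of [gamma] takes an argument because genericity constrains [f] along the curve only:
    inside, [f] may have infinitely many critical points. That the limit is attained comes from the
    values being natural numbers, among which there is a least one. *)

Lemma near_eq_differentiable (R : realType) (V W : normedModType R)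
    (f g : V -> W) (x : V) :
  (\forall y \near x, f y = g y) -> differentiable g x -> differentiable f x.
Proof.
move=> fg /[dup] dg /diff_locallyP[cg eg].
have efx : f \o shift x = cst (f x) + 'd g x +o_ 0 id.
  apply/eqaddoP => e e0; move/eqaddoP : eg => /(_ _ e0) ge.
  have fg0 : \forall h \near (0 : V), f (h + x) = g (h + x).
    by have := fg; rewrite (near_shift 0 x) /= subr0.
  near=> h.
  have -> : (f \o shift x - (cst (f x) + 'd g x)) h =
            (g \o shift x - (cst (g x) + 'd g x)) h.
    rewrite /= !fctE /= (nbhs_singleton fg).
    by have -> : f (h + x) = g (h + x) by near: h; exact: fg0.
  by near: h; exact: ge.
apply/diff_locallyP; have -> : 'd f x = 'd g x :> (V -> W) by exact: diff_unique.
by split.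
Unshelve. all: by end_near. Qed.

Section smooth_maps.
Context {R : realType} {V W : normedModType R}.
Implicit Types (f g : V -> W) (v x : V).

Lemma smooth_differentiable f : smooth f -> forall x, differentiable f x.
Proof. by move=> sf x; exact: (sf [::]). Qed.

Lemma smooth_derive f v : smooth f -> smooth ('D_v f).
Proof.
by move=> sf vs x; have := sf (rcons vs v) x; rewrite /iter_derive foldr_rcons.
Qed.

(* Coinduction: a class of differentiable maps closed under directional
   derivatives consists of smooth maps. *)
Lemma smooth_coind (P : (V -> W) -> Prop) :
  (forall g, P g ->
     (forall x, differentiable g x) /\ forall v, P (fun x => 'D_v g x)) ->
  forall f, P f -> smooth f.
Proof.
move=> PD f Pf vs; suff: P (iter_derive f vs) by case/PD=> + _; exact.
by elim: vs => //= v vs /PD[_]; exact.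
Qed.

(** An equality near [x] also holds near every point close to [x], so being locally equal to a
    smooth map is inherited by directional derivatives. This yields smoothness of functions defined
    by cases. *)
Lemma smooth_local f :
  (forall x, exists2 g, smooth g & \forall y \near x, f y = g y) -> smooth f.
Proof.
apply: (@smooth_coind (fun f => forall x, exists2 g, smooth g &
  \forall y \near x, f y = g y)) => {}f fP; split=> [x|v x].
  have [g sg fg] := fP x.
  by apply: near_eq_differentiable fg _; exact: smooth_differentiable.
have [g sg /nbhs_interior fg] := fP x; exists ('D_v g); first exact: smooth_derive.
by apply: filterS fg => y; exact: near_eq_derive.
Qed.

Lemma smooth_cst (w : W) : smooth (cst w : V -> W).
Proof.
apply: (@smooth_coind (fun f => exists w, f = cst w)); last by exists w.
move=> _ [{}w ->]; split=> [x|v]; first exact: differentiable_cst.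
by exists 0; apply/funext => x; rewrite derive_cst.
Qed.

End smooth_maps.

Section smooth_real.
Context {R : realType} {V : normedModType R}.
Implicit Types (f g : V -> R) (v x : V).

Lemma derive_comp (phi : R -> R) g x v :
  differentiable phi (g x) -> differentiable g x ->
  'D_v (phi \o g) x = 'D_1 phi (g x) * 'D_v g x.
Proof.
move=> dphi dg; rewrite !deriveE //; last exact: differentiable_comp.
rewrite diff_comp //= -[X in 'd phi _ X](mulr1 ('d g x v)).
by rewrite [LHS]linearZ mulrC.
Qed.

(** The derivative of a product is a sum of products, and that of a composite is a product with a
    composite. The operations are therefore treated together, in one class closed under
    derivatives. *)
Inductive smooth_alg : (V -> R) -> Prop :=
| smooth_alg_base g : smooth g -> smooth_alg g
| smooth_alg_comp (phi : R -> R) g : smooth phi -> smooth g -> smooth_alg (phi \o g)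
| smooth_alg_add g h : smooth_alg g -> smooth_alg h -> smooth_alg (g \+ h)
| smooth_alg_mul g h : smooth_alg g -> smooth_alg h -> smooth_alg (g \* h).

Lemma smooth_alg_smooth f : smooth_alg f -> smooth f.
Proof.
apply: smooth_coind => {}f fP.
suff: (forall x, differentiable f x) /\ forall v, smooth_alg ('D_v f) by [].
elim: f / fP => [g sg|phi g sphi sg|g h ag [dg Dg] ah [dh Dh]|g h ag [dg Dg] ah [dh Dh]].
- split=> [|v]; first exact: smooth_differentiable.
  exact/smooth_alg_base/smooth_derive.
- have dphi := smooth_differentiable sphi; have dg := smooth_differentiable sg.
  split=> [x|v]; first exact: differentiable_comp.
  rewrite (_ : 'D_v _ = ('D_1 phi \o g) \* 'D_v g).
    apply: smooth_alg_mul; first by apply: smooth_alg_comp => //; exact: smooth_derive.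
    exact/smooth_alg_base/smooth_derive.
  by apply/funext => x; rewrite derive_comp.
- split=> [x|v]; first exact: differentiableD.
  rewrite (_ : 'D_v _ = 'D_v g \+ 'D_v h); first exact: smooth_alg_add.
  by apply/funext => x; rewrite deriveD //; exact: diff_derivable.
- split=> [x|v]; first exact: differentiableM.
  rewrite (_ : 'D_v _ = (g \* 'D_v h) \+ (h \* 'D_v g)).
    by apply: smooth_alg_add; apply: smooth_alg_mul.
  by apply/funext => x; rewrite deriveM //; exact: diff_derivable.
Qed.

Lemma smoothD f g : smooth f -> smooth g -> smooth (f \+ g).
Proof.
by move=> sf sg; apply/smooth_alg_smooth/smooth_alg_add; exact: smooth_alg_base.
Qed.

Lemma smoothM f g : smooth f -> smooth g -> smooth (f \* g).
Proof.
by move=> sf sg; apply/smooth_alg_smooth/smooth_alg_mul; exact: smooth_alg_base.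
Qed.

Lemma smooth_comp (phi : R -> R) f : smooth phi -> smooth f -> smooth (phi \o f).
Proof. by move=> sphi sf; apply/smooth_alg_smooth/smooth_alg_comp. Qed.

Lemma smooth_linear (f : {linear V -> R}) : continuous f -> smooth f.
Proof.
move=> cf.
apply: (@smooth_coind _ _ _ (fun g => g = f \/ smooth g)); last by left.
move=> g [->|sg]; last first.
  by split=> [|v]; [exact: smooth_differentiable|right; exact: smooth_derive].
split=> [x|v]; first exact: linear_differentiable.
right; rewrite (_ : (fun _ => _) = cst (f v)); first exact: smooth_cst.
apply/funext => x; rewrite deriveE; last exact: linear_differentiable.
by rewrite diff_lin.
Qed.

End smooth_real.

(** * Flat exponential, smooth steps and thresholds *)

Section smooth_real_more.
Context {R : realType} {V : normedModType R}.
Implicit Types (f g : V -> R) (a : R).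

Lemma smoothMl a f : smooth f -> smooth (fun x => a * f x).
Proof. by move=> sf; apply: (@smoothM _ _ (cst a)) => //; exact: smooth_cst. Qed.

Lemma smoothB f g : smooth f -> smooth g -> smooth (fun x => f x - g x).
Proof.
move=> sf sg; rewrite (_ : (fun _ => _) = f \+ (fun x => -1 * g x)).
  by apply: smoothD => //; exact: smoothMl.
by apply/funext => x /=; rewrite mulN1r.
Qed.

Lemma smooth_deriveD f g (v x : V) :
  smooth f -> smooth g -> 'D_v (f \+ g) x = 'D_v f x + 'D_v g x.
Proof.
by move=> sf sg; rewrite deriveD //; apply: diff_derivable; exact: smooth_differentiable.
Qed.

Lemma smooth_deriveB f g (v x : V) :
  smooth f -> smooth g -> 'D_v (fun y => f y - g y) x = 'D_v f x - 'D_v g x.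
Proof.
by move=> sf sg; rewrite deriveB //; apply: diff_derivable; exact: smooth_differentiable.
Qed.

Lemma smooth_deriveM f g (v x : V) :
  smooth f -> smooth g -> 'D_v (f \* g) x = f x * 'D_v g x + g x * 'D_v f x.
Proof.
by move=> sf sg; rewrite deriveM //; apply: diff_derivable; exact: smooth_differentiable.
Qed.

End smooth_real_more.

Section flat_exponential.
Context {R : realType}.
Implicit Types (f : R -> R) (s u x : R) (k : nat).

Lemma smooth_id : smooth (@id R).
Proof. by apply: (@smooth_linear R R idfun) => x; exact: cvg_id. Qed.

Lemma deriveZr f v x : differentiable f x -> 'D_v f x = v * 'D_1 f x.
Proof.
by move=> df; rewrite !deriveE // -[X in 'd f x X = _](mulr1 v) [LHS]linearZ.
Qed.

Lemma is_derive_flat_point f x C :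
  (forall h, `|f (h + x) - f x| <= C * h ^+ 2) -> is_derive x 1 f 0.
Proof.
move=> fC; have C0 : 0 <= C.
  by have := fC 1; rewrite expr1n mulr1; exact: le_trans.
suff cvg0 : (fun h => h^-1 *: ((f \o shift x) (h *: 1) - f x)) @ 0^' --> (0 : R).
  apply: DeriveDef; first by apply/cvg_ex; exists 0.
  exact: cvg_lim cvg0.
apply/cvgr0Pnorm_le => e e0.
near=> h.
rewrite /= normrZ normfV ler_pdivrMl ?normr_gt0; last first.
  by near: h; exact: nbhs_dnbhs_neq.
rewrite [h%:A]mulr1 (le_trans (fC h)) // -(real_normK (num_real h)) expr2 mulrCA.
rewrite ler_wpM2l //.
(* [C] may be 0, whereas [C + 1] can be inverted. *)
rewrite (@le_trans _ _ ((C + 1) * `|h|)) //.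
  by rewrite ler_wpM2r // lerDl.
rewrite -ler_pdivlMl ?ltr_wpDl // ltW //.
near: h; apply: dnbhs0_lt.
by rewrite mulr_gt0 // invr_gt0 ltr_wpDl.
Unshelve. all: by end_near. Qed.

(** The powers of [s^-1] are carried along because differentiating [exp (-1/s)] produces them: the
    span of this family is closed under derivatives. *)
Definition flat_exp k s : R := if 0 < s then s^-1 ^+ k * expR (- s^-1) else 0.

Lemma flat_exp_ge0 k s : 0 <= flat_exp k s.
Proof.
by rewrite /flat_exp; case: ifPn => // s0; rewrite mulr_ge0 ?expR_ge0 ?exprn_ge0 ?invr_ge0 ?ltW.
Qed.

Lemma flat_exp_gt0 k s : 0 < s -> 0 < flat_exp k s.
Proof. by move=> s0; rewrite /flat_exp s0 mulr_gt0 ?expR_gt0 ?exprn_gt0 ?invr_gt0. Qed.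

Lemma flat_exp_le0 k s : s <= 0 -> flat_exp k s = 0.
Proof. by rewrite /flat_exp leNgt => /negbTE ->. Qed.

(** The term of order [k + 2] in the series of [exp (1/s)] bounds it from below. The quadratic bound
    makes the derivative at the origin vanish. *)
Lemma flat_exp_quadratic k s : flat_exp k s <= (k.+2)`!%:R * s ^+ 2.
Proof.
have [s0|s0] := ltP 0 s; last by rewrite flat_exp_le0 // mulr_ge0 ?sqr_ge0.
rewrite /flat_exp s0 expRN ler_pdivrMr ?expR_gt0 //.
have s1 : 0 <= s^-1 by rewrite invr_ge0 ltW.
have H2 : s^-1 ^+ k.+2 <= (k.+2)`!%:R * expR s^-1.
  apply: le_trans (_ : (k.+2)`!%:R * (1 + s^-1 ^+ k.+2 / (k.+2)`!%:R) <= _); last first.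
    by rewrite ler_wpM2l // expR_ge1Dxn.
  rewrite mulrDr mulrCA divff ?pnatr_eq0 -?lt0n ?fact_gt0 // !mulr1.
  by rewrite lerDr.
rewrite mulrAC -ler_pdivrMr ?exprn_gt0 //.
by rewrite -exprVn -exprD addn2.
Qed.

Lemma is_derive_flat_exp k s :
  is_derive s 1 (flat_exp k) (flat_exp k.+2 s - k%:R * flat_exp k.+1 s).
Proof.
have [s0|s0|->] := ltgtP s 0.
- rewrite !flat_exp_le0 ?ltW // mulr0 subr0.
  apply: (@near_eq_is_derive _ _ _ (cst 0)).
  near=> y; rewrite flat_exp_le0 // ltW //; near: y; exact: lt_nbhsl.
- have ds : is_derive s 1 (fun y : R => y^-1) (- (s ^- 2)).
    have := @is_deriveV R id s 1 1 (lt0r_neq0 s0) (is_derive_id _ _).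
    by rewrite [_%:A]mulr1.
  have dX := @is_deriveX _ _ _ k _ _ _ ds.
  have dN := @is_deriveN _ _ _ _ _ _ _ ds.
  have dE := @is_derive1_comp _ expR (- (fun y : R => y^-1)) _ _ _ (is_derive_expR _) dN.
  have dM := @is_deriveM _ _ _ _ _ _ _ _ dX dE.
  apply: (@near_eq_is_derive _ _ _ ((fun y : R => y^-1) ^+ k * (expR \o (- (fun y : R => y^-1))))).
    near=> y; rewrite /flat_exp ifT; last by near: y; exact: lt_nbhsr.
    by rewrite /= !fctE.
  apply: is_derive_eq; rewrite /flat_exp s0 /= !fctE /GRing.scale /= opprK.
  rewrite -exprVn; set y := s^-1; set e := expR _.
  case: k {dX dM} => [|k] /=; first by rewrite !mul0r !expr0; ring.
  by rewrite !exprS; ring.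
- rewrite !flat_exp_le0 // mulr0 subr0.
  apply: (@is_derive_flat_point _ _ ((k.+2)`!%:R)) => h.
  rewrite addr0 (flat_exp_le0 _ (lexx 0)) subr0 ger0_norm ?flat_exp_ge0 //.
  exact: flat_exp_quadratic.
Unshelve. all: by end_near. Qed.

Lemma differentiable_flat_exp k s : differentiable (flat_exp k) s.
Proof.
by apply/derivable1_diffP; have := is_derive_flat_exp k s => /@ex_derive.
Qed.

Inductive flat_span : (R -> R) -> Prop :=
| flat_span_base a k : flat_span (fun s => a * flat_exp k s)
| flat_span_add f g : flat_span f -> flat_span g -> flat_span (f \+ g).

Lemma smooth_flat_exp k : smooth (flat_exp k).
Proof.
have : flat_span (flat_exp k).
  by rewrite (_ : flat_exp k = fun s => 1 * flat_exp k s);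
    [exact: flat_span_base|apply/funext => s; rewrite mul1r].
apply: smooth_coind => f fP.
suff: (forall x, differentiable f x) /\ forall v, flat_span ('D_v f) by [].
elim: f / fP => [a {}k|f g _ [df Df] _ [dg Dg]].
  have da x : differentiable (fun s => a * flat_exp k s) x.
    by apply: differentiableM; [exact: differentiable_cst|exact: differentiable_flat_exp].
  split=> // v.
  rewrite (_ : 'D_v _ = (fun s => (v * a) * flat_exp k.+2 s) \+
                        (fun s => (- k%:R * v * a) * flat_exp k.+1 s)).
    by apply: flat_span_add; exact: flat_span_base.
  apply/funext => x; rewrite deriveZr //.
  have := is_derive_flat_exp k x => dk.
  rewrite (@deriveM _ _ (cst a) (flat_exp k)) //= derive_cst scaler0 addr0.
  rewrite derive_val /GRing.scale /=; ring.
split=> [x|v]; first exact: differentiableD.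
rewrite (_ : 'D_v _ = 'D_v f \+ 'D_v g); first exact: flat_span_add.
by apply/funext => x; rewrite deriveD //; exact: diff_derivable.
Qed.

Lemma flat_exp_le x y : x <= y -> flat_exp 0 x <= flat_exp 0 y.
Proof.
move=> xy; have [x0|x0] := ltP 0 x; last by rewrite flat_exp_le0 // flat_exp_ge0.
have y0 := lt_le_trans x0 xy.
by rewrite /flat_exp x0 y0 !expr0 !mul1r ler_expR lerN2 lef_pV2.
Qed.

(** With [E = flat_exp 0] the step is [E (1 - E x / E b) / E 1]. The argument of the outer [E] is 1
    for [x <= 0] and, [E] being monotone, nonpositive for [b <= x]. *)
Lemma smooth_step (b : R) : 0 < b -> exists S : R -> R,
  [/\ smooth S, forall x, 0 <= S x <= 1, forall x, x <= 0 -> S x = 1 &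
      forall x, b <= x -> S x = 0].
Proof.
move=> b0; have eb := flat_exp_gt0 0 b0; have e1 := flat_exp_gt0 0 (@ltr01 R).
exists (fun x => (flat_exp 0 1)^-1 * flat_exp 0 (1 - (flat_exp 0 b)^-1 * flat_exp 0 x)).
split=> [|x|x x0|x bx].
- apply: smoothMl; apply: smooth_comp; first exact: smooth_flat_exp.
  apply: smoothB; first exact: smooth_cst.
  by apply: smoothMl; exact: smooth_flat_exp.
- rewrite mulr_ge0 ?invr_ge0 ?flat_exp_ge0 //= ler_pdivrMl // mulr1.
  by apply: flat_exp_le; rewrite gerBl mulr_ge0 ?invr_ge0 ?flat_exp_ge0.
- by rewrite (flat_exp_le0 _ x0) mulr0 subr0 mulVf // lt0r_neq0.
- rewrite [X in _ * X]flat_exp_le0 ?mulr0 // subr_le0 ler_pdivlMl // mulr1.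
  exact: flat_exp_le.
Qed.

(* [soft s] is a smooth substitute for [max s 0]: its slope stays in [0, 1],
   because [exp (-1/s) * (1 + 1/s) <= 1], and [s - soft s] stays in [0, 1]. *)
Definition soft s := s * flat_exp 0 s.

Lemma smooth_soft : smooth soft.
Proof. by apply: (@smoothM _ _ id); [exact: smooth_id|exact: smooth_flat_exp]. Qed.

Lemma soft_le0 s : s <= 0 -> soft s = 0.
Proof. by move=> s0; rewrite /soft flat_exp_le0 // mulr0. Qed.

Lemma soft_bound s : 0 <= s -> 0 <= s - soft s <= 1.
Proof.
rewrite le_eqVlt => /predU1P[<-|s0]; first by rewrite soft_le0 // subr0 lexx ler01.
rewrite /soft /flat_exp s0 expr0 mul1r.
have e1 : expR (- s^-1) <= 1.
  by rewrite -expR0 ler_expR oppr_le0 invr_ge0 ltW.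
have e2 := expR_ge1Dx (- s^-1).
have : s * (1 - s^-1) <= s * expR (- s^-1) by rewrite ler_pM2l.
rewrite mulrBr mulr1 divff ?lt0r_neq0 // => e3.
have : s * expR (- s^-1) <= s * 1 by rewrite ler_pM2l.
by rewrite mulr1; lra.
Qed.

Lemma derive_soft s : 0 <= 'D_1 soft s <= 1.
Proof.
have d0 := is_derive_flat_exp 0 s; have di := @is_derive_id R R s 1.
have -> : 'D_1 soft s = flat_exp 0 s + s * flat_exp 2 s.
  have := @is_deriveM _ _ _ _ _ _ _ _ di d0 => /@derive_val ->.
  by rewrite mul0r subr0 /GRing.scale /= mulr1 addrC.
have [s0|s0] := ltP 0 s; last by rewrite !flat_exp_le0 // mulr0 addr0 lexx ler01.
rewrite addr_ge0 ?mulr_ge0 ?flat_exp_ge0 ?(ltW s0) //=.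
rewrite /flat_exp s0 expRN.
have -> : s^-1 ^+ 0 / expR s^-1 + s * (s^-1 ^+ 2 / expR s^-1) = (1 + s^-1) / expR s^-1.
  by field; rewrite lt0r_neq0 ?expR_gt0 // lt0r_neq0.
rewrite ler_pdivrMr ?expR_gt0 // mul1r.
exact: expR_ge1Dx.
Qed.

(** Two copies of [soft], scaled by [e], start at [e] and at [-e], and at most one of them is
    nonzero at a given [u]. The error [2 * e] is made of [e] for the dead zone and [e] for the gap
    between [s] and [soft s]. *)
Lemma smooth_threshold (e : R) : 0 < e -> exists phi : R -> R,
  [/\ smooth phi, forall u, `|u| <= e -> phi u = 0,
      forall u, 0 <= 'D_1 phi u <= 1 &
      forall u, `|u - phi u| <= 2 * e].
Proof.
move=> e0.
have e0' := lt0r_neq0 e0.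
pose l u := e^-1 * u - 1; pose l' u := - e^-1 * u - 1.
have sl : smooth l.
  by apply: smoothB; [apply: smoothMl; exact: smooth_id|exact: smooth_cst].
have sl' : smooth l'.
  by apply: smoothB; [apply: smoothMl; exact: smooth_id|exact: smooth_cst].
have ssl : smooth (soft \o l) by apply: smooth_comp => //; exact: smooth_soft.
have ssl' : smooth (soft \o l') by apply: smooth_comp => //; exact: smooth_soft.
have Daff a u : 'D_1 (fun u => a * u - 1) u = a.
  have di := @is_derive_id R R u 1.
  rewrite (_ : (fun _ => _) = (a \*: id) - cst 1); last by apply/funext.
  by rewrite derive_val /= subr0 [LHS]mulr1.
exists (fun u => e * (soft (l u) - soft (l' u))); split=> [|u|u|u].
- by apply: smoothMl; exact: smoothB.
- rewrite ler_norml => /andP[u1 u2]; rewrite !soft_le0 ?subr0 ?mulr0 //.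
    by rewrite /l' mulNr subr_le0 -mulrN ler_pdivrMl // mulr1 lerNl.
  by rewrite /l subr_le0 ler_pdivrMl // mulr1.
- have -> : 'D_1 (fun u => e * (soft (l u) - soft (l' u))) u =
      'D_1 soft (l u) + 'D_1 soft (l' u).
    have sD : smooth (fun u => soft (l u) - soft (l' u)) by exact: smoothB.
    rewrite (smooth_deriveM (f := cst e)) ?derive_cst ?mulr0 ?addr0 //; last exact: smooth_cst.
    rewrite (smooth_deriveB _ _ ssl ssl') !derive_comp ?Daff; try exact: smooth_differentiable.
    all: try by apply: smooth_differentiable; exact: smooth_soft.
    by rewrite /cst; field.
  have [u0|u0] := leP 0 u.
    have -> : 'D_1 soft (l' u) = 0.
      rewrite (@near_eq_derive _ _ _ _ (cst 0)) ?derive_cst //.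
      near=> y; rewrite soft_le0 // ltW //; near: y; apply: lt_nbhsl.
      rewrite /l' mulNr; have : 0 <= e^-1 * u by rewrite mulr_ge0 // invr_ge0 ltW.
      lra.
    by rewrite addr0 derive_soft.
  have -> : 'D_1 soft (l u) = 0.
    rewrite (@near_eq_derive _ _ _ _ (cst 0)) ?derive_cst //.
    near=> y; rewrite soft_le0 // ltW //; near: y; apply: lt_nbhsl.
    rewrite /l; have : e^-1 * u <= 0 by rewrite pmulr_rle0 ?invr_gt0 // ltW.
    lra.
  by rewrite add0r derive_soft.
- have key t : 0 <= t -> `|t - e * soft (e^-1 * t - 1)| <= 2 * e.
    move=> t0; have [te|te] := leP t e.
      rewrite soft_le0; first by rewrite mulr0 subr0 ger0_norm //; lra.
      by rewrite subr_le0 ler_pdivrMl // mulr1.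
    have v0 : 0 <= e^-1 * t - 1 by rewrite subr_ge0 ler_pdivlMl // mulr1 ltW.
    have /andP[b1 b2] := soft_bound v0.
    have -> : t - e * soft (e^-1 * t - 1) =
       e + e * ((e^-1 * t - 1) - soft (e^-1 * t - 1)) by field.
    rewrite ger0_norm; last by rewrite addr_ge0 ?mulr_ge0 // ltW.
    suff : e * (e^-1 * t - 1 - soft (e^-1 * t - 1)) <= e * 1 by lra.
    by rewrite ler_pM2l.
  have [u0|u0] := leP 0 u.
    have -> : soft (l' u) = 0.
      apply: soft_le0; rewrite /l' mulNr.
      have : 0 <= e^-1 * u by rewrite mulr_ge0 // invr_ge0 ltW.
      lra.
    by rewrite subr0 /l; exact: key.
  have -> : soft (l u) = 0.
    apply: soft_le0; rewrite /l.
    have : e^-1 * u <= 0 by rewrite pmulr_rle0 ?invr_gt0 // ltW.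
    lra.
  have := key (- u); rewrite oppr_ge0 ltW // => /(_ isT).
  rewrite mulrN -mulNr -/(l' u) sub0r mulrN opprK.
  by rewrite -normrN opprD !opprK.
Unshelve. all: by end_near. Qed.

End flat_exponential.

(** * Smooth Urysohn functions in the plane *)

Section plane_urysohn.
Context {R : realType}.
Local Notation plane := (R * R)%type.
Implicit Types (p x y : plane) (K O : set plane).

Lemma smooth_fst : smooth (fst : plane -> R).
Proof. by apply: (@smooth_linear R plane fst) => x; exact: cvg_fst. Qed.

Lemma smooth_snd : smooth (snd : plane -> R).
Proof. by apply: (@smooth_linear R plane snd) => x; exact: cvg_snd. Qed.

Lemma plane_normE p : `|p| = Num.max `|p.1| `|p.2|.
Proof. by []. Qed.

Lemma plane_bump O p : nbhs p O -> exists B : plane -> R,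
  [/\ smooth B, forall x, 0 <= B x, 0 < B p &
      forall x, ~ O x -> \forall y \near x, B y = 0].
Proof.
move=> /nbhs_ballP[r /= r0 rO].
(* The Euclidean disk of radius [r / 2] lies in the sup-norm ball of radius [r] with a margin, so
   the bump vanishes in a neighbourhood of each point outside [O]. *)
pose q x := (r / 2) ^+ 2 - ((x.1 - p.1) ^+ 2 + (x.2 - p.2) ^+ 2).
exists (flat_exp 0 \o q); split=> [|x||x nOx].
- apply: smooth_comp; first exact: smooth_flat_exp.
  have s1 : smooth (fun x : plane => x.1 - p.1).
    by apply: smoothB; [exact: smooth_fst|exact: smooth_cst].
  have s2 : smooth (fun x : plane => x.2 - p.2).
    by apply: smoothB; [exact: smooth_snd|exact: smooth_cst].
  by apply: smoothB; [exact: smooth_cst|apply: smoothD; exact: smoothM].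
- exact: flat_exp_ge0.
- by apply: flat_exp_gt0; rewrite /q !subrr expr0n /= addr0 subr0 exprn_gt0 ?divr_gt0.
- have rxp : r <= `|x - p|.
    rewrite leNgt; apply/negP => xp; apply/nOx/rO.
    by rewrite -ball_normE /ball_ /= distrC.
  have r4 : 0 < r / 4 by rewrite divr_gt0.
  near=> y; apply: flat_exp_le0; rewrite /q subr_le0.
  have yx : `|x - y| < r / 4.
    by near: y; have := @nbhsx_ballx _ _ x _ r4; rewrite -ball_normE.
  have : r / 2 <= `|y - p|.
    have := ler_distD y x p; lra.
  rewrite plane_normE /= le_max => /orP[] h.
    rewrite -(real_normK (num_real (_ - p.1))).
    apply: le_trans (_ : `|y.1 - p.1| ^+ 2 <= _); last by rewrite lerDl sqr_ge0.
    by rewrite lerXn2r ?nnegrE //; lra.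
  rewrite -(real_normK (num_real (_ - p.2))).
  apply: le_trans (_ : `|y.2 - p.2| ^+ 2 <= _); last by rewrite lerDr sqr_ge0.
  by rewrite lerXn2r ?nnegrE //; lra.
Unshelve. all: by end_near. Qed.

Lemma smooth_urysohn K O : compact K -> (forall x, K x -> nbhs x O) ->
  exists chi : plane -> R,
  [/\ smooth chi, forall x, 0 <= chi x <= 1,
      forall x, K x -> \forall y \near x, chi y = 0 &
      forall x, ~ O x -> \forall y \near x, chi y = 1].
Proof.
move=> /compact_near_coveringP cK KO.
pose adm (B : plane -> R) := [/\ smooth B, forall x, 0 <= B x &
  forall x, ~ O x -> \forall y \near x, B y = 0].
pose above (B : plane -> R) := [set B' | adm B' /\ forall x, B x <= B' x].
(* Near-covering along the filter of large bump functions supported in [O]: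
   a sum of bumps dominates each of them, so no finite subcover is extracted. *)
have FF : Filter (filter_from adm above).
  apply: filter_from_filter.
    exists (cst 0); split; first exact: smooth_cst.
      by move=> x; exact: lexx.
    by move=> x _; apply: filterE.
  move=> B B' [sB B0 BO] [sB' B'0 B'O]; exists (B \+ B').
    split; [exact: smoothD|by move=> x /=; rewrite addr_ge0|].
    move=> x nOx; near=> y => /=.
    have -> : B y = 0 by near: y; exact: BO.
    have -> : B' y = 0 by near: y; exact: B'O.
    by rewrite addr0.
  move=> C [aC BC]; split; split=> // x; apply: le_trans (BC x) => /=.
    by rewrite lerDl.
  by rewrite lerDr.
have := cK _ _ (fun B x => 1 <= B x) FF.
case=> [x Kx|B0 aB0 B0K].
  have [B [sB B0 Bx BO]] := plane_bump (KO _ Kx).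
  (* Normalized to the value 2 at [x], hence above 1 near [x]. *)
  pose C := (fun y => (2 / B x) * B y).
  have sC : smooth C by exact: smoothMl.
  have cC : {for x, continuous C}.
    by apply: differentiable_continuous; exact: smooth_differentiable.
  exists ([set y | 1 < C y], above C); last first.
    by move=> [y D] /= [/ltW Cy [_ CD]]; exact: le_trans (CD y).
  split => /=; last first.
    exists C => //; split => // [y|y nOy].
      by rewrite mulr_ge0 // divr_ge0 // ltW.
    by have := BO _ nOy; apply: filterS => z; rewrite /C => ->; rewrite mulr0.
  apply: (cC [set z | 1 < z]); apply: lt_nbhsr; rewrite /C divfK ?lt0r_neq0 //; lra.
have [sB B_ge0 BO] := aB0.
have BK : forall x, K x -> 1 <= B0 x by apply: B0K; split.
(* As [1 <= B0] on [K], stopping the step at [1 / 2] makes it vanish near [K] and not just on it. *)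
have [S [sS S01 S1 S0]] := @smooth_step R (1 / 2) ltac:(lra).
exists (S \o B0); split=> [|x|x Kx|x nOx]; [exact: smooth_comp|exact: S01| |].
- have cB : {for x, continuous B0}.
    by apply: differentiable_continuous; exact: smooth_differentiable.
  near=> y; apply: S0; apply: ltW; near: y; apply: (cB [set z | 1 / 2 < z]); apply: lt_nbhsr.
  by have := BK _ Kx; lra.
- by near=> y => /=; apply: S1; rewrite (_ : B0 y = 0) //; near: y; exact: BO.
Unshelve. all: by end_near. Qed.

End plane_urysohn.

(** * Complementary components of a closed curve *)

Section components.
Context {R : realType} {V : normedModType R}.
Implicit Types (A : set V) (p q v x : V).

Lemma segment_component A p q :
  (forall s : R, 0 <= s <= 1 -> A (p + s *: (q - p))) ->
  connected_component A p q.
Proof.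
move=> Aseg; pose sg (s : R) := p + s *: (q - p).
have csg : continuous sg.
  by move=> s; apply: cvgD; [exact: cvg_cst|apply: cvgZl; exact: cvg_id].
have csgI : connected (sg @` `[0, 1]).
  apply: connected_continuous_connected.
    by apply/connected_intervalP; exact: interval_is_interval.
  exact: continuous_subspaceT.
apply: (@connected_component_max _ _ (sg @` `[0, 1]) p) => //.
- by exists 0; rewrite /sg ?scale0r ?addr0 //= in_itv /= lexx ler01.
- by move=> _ [s /= s01 <-]; apply: Aseg; rewrite in_itv /= in s01.
- by exists 1; rewrite /sg ?scale1r ?subrKC //= in_itv /= lexx ler01.
Qed.

Lemma ball_component A p q (e : R) : ball p e `<=` A -> `|p - q| < e ->
  connected_component A p q.
Proof.
rewrite -ball_normE => peA pq; apply: segment_component => s /andP[s0 s1].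
apply: peA; rewrite /ball_ /= opprD addNKr normrN normrZ ger0_norm //.
by rewrite (le_lt_trans _ pq) // distrC ler_piMl.
Qed.

Lemma component_open A p : open A -> open (connected_component A p).
Proof.
rewrite !openE => oA q pq.
have /oA/nbhs_ballP[e /= e0 qeA] := @connected_component_sub _ _ _ _ pq.
apply/nbhs_ballP; exists e => //= y; rewrite -ball_normE /ball_ /= => qy.
exact: connected_component_trans pq (ball_component qeA qy).
Qed.

Lemma ray_component_unbounded A p v : v != 0 ->
  (forall s : R, 0 <= s -> A (p + s *: v)) ->
  ~ bounded_set (connected_component A p).
Proof.
move=> v0 Aray [M [_ /(_ (M + 1))]]; rewrite ltrDl ltr01 => /(_ isT) bM.
have nv : 0 < `|v| by rewrite normr_gt0.
(* Then [|p + s v| >= |s v| - |p| = |M| + 2], which exceeds the bound [M + 1]. *)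
pose s := (`|M| + 2 + `|p|) / `|v|.
have s0 : 0 <= s by rewrite divr_ge0.
have /bM : connected_component A p (p + s *: v).
  apply: segment_component => t /andP[t0 _].
  by rewrite addrAC subrr add0r scalerA; apply: Aray; rewrite mulr_ge0.
have := lerB_normD (s *: v) p.
rewrite normrZ ger0_norm // divfK ?lt0r_neq0 // [s *: v + p]addrC /=.
have := ler_norm M; lra.
Qed.

End components.

Section curves.
Context {R : realType}.
Local Notation plane := (R * R)%type.
Implicit Types (c : R -> plane) (p q x : plane) (t s : R).

(** Defined by unboundedness of the component, so that the division of the plane into interior,
    curve and exterior is a mere case distinction. *)
Definition exterior_of c : set plane :=
  [set p | ~ range c p /\
    ~ bounded_set (connected_component (~` range c) p)].

Variables (c : R -> plane) (scc : simple_closed_curve c).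

Let smooth_c : smooth c. Proof. by case: scc. Qed.

Lemma curve_continuous : continuous c.
Proof. by move=> t; apply: differentiable_continuous; exact: smooth_differentiable. Qed.

Lemma curve_periodic t (n : int) : c (t + n%:~R) = c t.
Proof.
have cS s : c (s + 1) = c s by case: scc.
have cn (n' : nat) s : c (s + n'%:R) = c s.
  by elim: n' => [|m IH]; rewrite ?addr0 // -natr1 addrA cS.
case: n => n; first exact: cn.
by rewrite -[in RHS](subrK n.+1%:R t) cn NegzE mulrNz.
Qed.

Lemma curve_fract t : c t = c (t - (Num.floor t)%:~R).
Proof. by rewrite -mulrNz curve_periodic. Qed.

Lemma fract_itv t : t - (Num.floor t)%:~R \in `[0, 1[.
Proof.
rewrite in_itv /= subr_ge0 floor_le //= ltrBlDl.
by have := floorD1_gt t; rewrite intrD.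
Qed.

Lemma curve_range : range c = c @` `[0, 1].
Proof.
apply/seteqP; split=> [_ [t _ <-]|_ [t _ <-]]; last by exists t.
exists (t - (Num.floor t)%:~R); last by rewrite -curve_fract.
by have := fract_itv t; rewrite /= !in_itv /= => /andP[-> /ltW ->].
Qed.

Lemma curve_compact : compact (range c).
Proof.
rewrite curve_range; apply: continuous_compact; last exact: segment_compact.
by apply: continuous_subspaceT; exact: curve_continuous.
Qed.

Lemma curve_closed : closed (range c).
Proof. by apply: compact_closed; [exact: norm_hausdorff|exact: curve_compact]. Qed.

Lemma curve_compl_open : open (~` range c).
Proof. by rewrite openC; exact: curve_closed. Qed.

Lemma interior_component p q : connected_component (~` range c) p q ->
  interior_of c p -> interior_of c q.
Proof.
move=> pq [_ bp]; split; first exact: connected_component_sub pq.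
by rewrite -(same_connected_component pq).
Qed.

Lemma exterior_component p q : connected_component (~` range c) p q ->
  exterior_of c p -> exterior_of c q.
Proof.
move=> pq [_ bp]; split; first exact: connected_component_sub pq.
by rewrite -(same_connected_component pq).
Qed.

Lemma interior_open : open (interior_of c).
Proof.
rewrite openE => p ip.
have := @component_open _ _ (~` range c) p curve_compl_open.
rewrite openE => /(_ p) /(_ (connected_component_refl ip.1)).
by apply: filterS => q /interior_component; exact.
Qed.

Lemma exterior_open : open (exterior_of c).
Proof.
rewrite openE => p ip.
have := @component_open _ _ (~` range c) p curve_compl_open.
rewrite openE => /(_ p) /(_ (connected_component_refl ip.1)).
by apply: filterS => q /exterior_component; exact.
Qed.

Lemma interiorNexterior p : interior_of c p -> exterior_of c p -> False.
Proof. by move=> [_ bp] [_]. Qed.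

Lemma curve_trichotomy p : [\/ interior_of c p, range c p | exterior_of c p].
Proof.
have [rp|nrp] := pselect (range c p); first exact: Or32.
have [bp|nbp] := pselect (bounded_set (connected_component (~` range c) p)).
  exact: Or31.
exact: Or33.
Qed.

Lemma exteriorNclosure p : exterior_of c p -> ~ closure (interior_of c) p.
Proof.
move=> ep /(_ (exterior_of c)) [|q [iq eq]]; last exact: interiorNexterior eq.
by have := exterior_open; rewrite openE; exact.
Qed.

Lemma closure_interior_sub p :
  closure (interior_of c) p -> interior_of c p \/ range c p.
Proof.
by move=> cp; case: (curve_trichotomy p) => [|| /exteriorNclosure]; tauto.
Qed.

(** A point farther out than the whole curve escapes to infinity along its radial ray [p + s p]
    without meeting the curve, so its component is unbounded. *)
Lemma interior_bounded : exists2 r : R, 0 <= r &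
  forall p, closure (interior_of c) p -> `|p| <= r.
Proof.
have [M [_ bM]] := compact_bounded curve_compact.
pose r := `|M| + 1.
have rM : M < r by rewrite (le_lt_trans (ler_norm _)) // ltrDl.
have cr q : range c q -> `|q| <= r by exact: bM.
have r0 : 0 <= r by rewrite addr_ge0.
exists r => // p /closure_interior_sub[[nrp bp]|]; last exact: cr.
rewrite leNgt; apply/negP => rp; apply: (@ray_component_unbounded _ _ _ p p _ _ bp).
  by rewrite -normr_gt0 (le_lt_trans r0).
move=> s s0 /cr; rewrite -[X in X + _]scale1r -scalerDl normrZ ger0_norm ?addr_ge0 //.
have : 1 * `|p| <= (1 + s) * `|p| by rewrite ler_wpM2r // lerDl.
lra.
Qed.

End curves.

(** * Local structure of a closed curve *)

Section curve_coordinates.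
Context {R : realType}.
Local Notation plane := (R * R)%type.
Implicit Types (p q u v w : plane) (t s : R).

Lemma dotpDl u v w : dotp (u + v) w = dotp u w + dotp v w.
Proof. by rewrite /dotp /=; ring. Qed.

Lemma dotpBl u v w : dotp (u - v) w = dotp u w - dotp v w.
Proof. by rewrite /dotp /=; ring. Qed.

Lemma dotpZl a u w : dotp (a *: u) w = a * dotp u w.
Proof.
rewrite /dotp -[(a *: u).1]/(a * u.1) -[(a *: u).2]/(a * u.2); ring.
Qed.

Lemma dotpC u v : dotp u v = dotp v u.
Proof. by rewrite /dotp; ring. Qed.

Lemma dotp_gt0 u : u != 0 -> 0 < dotp u u.
Proof.
move=> u0; rewrite lt0r /dotp -!expr2 addr_ge0 ?sqr_ge0 // andbT.
by rewrite paddr_eq0 ?sqr_ge0 // !sqrf_eq0; case: u u0.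
Qed.

Lemma smooth_lin_comp (V W W' : normedModType R)
    (L : {linear W -> W'}) (g : V -> W) :
  continuous L -> smooth g ->
  smooth (L \o g) /\ forall (v x : V), 'D_v (L \o g) x = L ('D_v g x).
Proof.
move=> cL.
have dL y : differentiable L y by exact: linear_differentiable.
have DL h (sh : smooth h) (v x : V) : 'D_v (L \o h : V -> W') x = L ('D_v h x).
  rewrite !deriveE; try exact: smooth_differentiable.
    by rewrite diff_comp //= ?diff_lin //; exact: smooth_differentiable.
  by apply: differentiable_comp => //; exact: smooth_differentiable.
move=> sg; split=> [|v x]; last exact: DL.
apply: (@smooth_coind _ _ _ (fun f => exists2 h, smooth h & f = L \o h)); last by exists g.
move=> _ [h sh ->]; split=> [x|v].
  by apply: differentiable_comp => //; exact: smooth_differentiable.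
exists ('D_v h); first exact: smooth_derive.
by apply/funext => x; rewrite DL.
Qed.

Lemma smooth_dotp (c : R -> plane) p u : smooth c ->
  smooth (fun t => dotp (c t - p) u) /\
  forall t, 'D_1 (fun t => dotp (c t - p) u) t = dotp ('D_1 c t) u.
Proof.
move=> sc.
have c1 : continuous (fst : plane -> R) by move=> x; exact: cvg_fst.
have c2 : continuous (snd : plane -> R) by move=> x; exact: cvg_snd.
have [s1 D1] := @smooth_lin_comp R plane R fst c c1 sc.
have [s2 D2] := @smooth_lin_comp R plane R snd c c2 sc.
have -> : (fun t => dotp (c t - p) u) =
    (fun t => u.1 * (c t).1) \+ (fun t => u.2 * (c t).2) \+ cst (- dotp p u).
  by apply/funext => t; rewrite /dotp /=; ring.
have m1 : smooth (fun t => u.1 * (c t).1) by exact: smoothMl.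
have m2 : smooth (fun t => u.2 * (c t).2) by exact: smoothMl.
split; first by do 2?[apply: smoothD => //]; exact: smooth_cst.
move=> t.
have sC : smooth (cst (- dotp p u) : R -> R) by exact: smooth_cst.
rewrite (smooth_deriveD _ _ (smoothD m1 m2) sC) (smooth_deriveD _ _ m1 m2) derive_cst addr0.
rewrite (smooth_deriveM (f := cst u.1) _ _ _ s1); last exact: smooth_cst.
rewrite (smooth_deriveM (f := cst u.2) _ _ _ s2); last exact: smooth_cst.
rewrite !derive_cst D1 D2 /=.
by rewrite /dotp; ring.
Qed.

Definition rotp u : plane := (- u.2, u.1).

Lemma dotp_coord_inj u v p q : u != 0 -> (v = rotp u \/ v = - rotp u) ->
  dotp p u = dotp q u -> dotp p v = dotp q v -> p = q.
Proof.
move=> u0 uv e1 e2.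
have {uv}{}e2 : dotp p (rotp u) = dotp q (rotp u).
  by case: uv e2 => ->; rewrite /dotp /=; lra.
have := dotp_gt0 u0; set d := dotp u u => d0.
have eq1 : d * p.1 = d * q.1.
  transitivity (u.1 * dotp p u - u.2 * dotp p (rotp u)).
    by rewrite /d /dotp /=; ring.
  by rewrite e1 e2 /d /dotp /=; ring.
have eq2 : d * p.2 = d * q.2.
  transitivity (u.2 * dotp p u + u.1 * dotp p (rotp u)).
    by rewrite /d /dotp /=; ring.
  by rewrite e1 e2 /d /dotp /=; ring.
rewrite [p]surjective_pairing [q]surjective_pairing.
by congr pair; apply: (mulfI (lt0r_neq0 d0)).
Qed.

Lemma dotp_continuous p u : continuous (fun q : plane => dotp (q - p) u).
Proof.
rewrite (_ : (fun _ => _) = fun q => (u.1 * q.1 + u.2 * q.2) - dotp p u); last first.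
  by apply/funext => q; rewrite /dotp /=; ring.
move=> q; apply: cvgB; last exact: cvg_cst.
by apply: cvgD; apply: cvgM; try exact: cvg_cst; [exact: cvg_fst|exact: cvg_snd].
Qed.

End curve_coordinates.

(** * Graph coordinates around a point of the curve *)

Section sides.
Context {R : realType}.
Local Notation plane := (R * R)%type.
Implicit Types (p q u v w : plane) (t s : R).
Variables (c : R -> plane) (scc : simple_closed_curve c).

Let smooth_c : smooth c. Proof. by case: scc. Qed.

Lemma curve_inj t s : c t = c s -> exists n : int, t = s + n%:~R.
Proof.
move=> cts; have [_ _ inj_c _] := scc.
have := inj_c _ _ (fract_itv t) (fract_itv s).
rewrite -!(curve_fract scc) => /(_ cts) e.
exists (Num.floor t - Num.floor s).
by rewrite intrD mulrNz; move: e; lra.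
Qed.

(* A box around [c t0], in the coordinates given by the orthogonal vectors
   ['D_1 c t0] and [nu], in which the curve is a graph over the first
   coordinate. *)
Definition graph_box t0 (nu : plane) (d a r : R) :=
  let X q := dotp (q - c t0) ('D_1 c t0) in
  let Y q := dotp (q - c t0) nu in
  [/\ [/\ 0 < a, 0 < d & 0 < r],
      forall q, range c q -> `|X q| < a -> `|Y q| < r ->
        exists2 t, `|t - t0| < d & c t = q,
      forall t s, `|t - t0| < d -> `|s - t0| < d -> X (c t) = X (c s) -> t = s,
      forall t, `|t - t0| < d -> `|Y (c t)| < r / 2 &
      forall x, `|x| < a -> exists2 t, `|t - t0| < d & X (c t) = x].

Lemma graph_boxN t0 nu d a r : graph_box t0 nu d a r -> graph_box t0 (- nu) d a r.
Proof.
have N q : `|dotp (q - c t0) (- nu)| = `|dotp (q - c t0) nu|.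
  by rewrite -normrN /dotp /=; congr `|_|; ring.
move=> [? H2 ? H4 ?]; split=> // [q|t]; rewrite N; [exact: H2|exact: H4].
Qed.

(** Near [t0] the coordinate [X] is strictly increasing. On the rest of a period [X] and [Y] cannot
    both be small, by injectivity and compactness; this gives [r]. Then [d] is shrunk until
    [|Y| < r / 2], which leaves a band free of the curve, and [a] is chosen so that [X] attains
    every value in []-a, a[]. *)
Lemma graph_box_exists t0 nu : dotp nu ('D_1 c t0) = 0 -> nu != 0 ->
  (nu = rotp ('D_1 c t0) \/ nu = - rotp ('D_1 c t0)) ->
  exists d a r, graph_box t0 nu d a r.
Proof.
set u := 'D_1 c t0 => nuu nu0 nurot.
have u0 : u != 0 by have [_ _ _] := scc; exact.
pose X t := dotp (c t - c t0) u; pose Y t := dotp (c t - c t0) nu.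
have [sX DX] := smooth_dotp (c t0) u smooth_c.
have [sY _] := smooth_dotp (c t0) nu smooth_c.
rewrite -/X in sX DX; rewrite -/Y in sY.
have cX : continuous X by move=> t; apply: differentiable_continuous; exact: smooth_differentiable.
have cY : continuous Y by move=> t; apply: differentiable_continuous; exact: smooth_differentiable.
have cDX : continuous ('D_1 X).
  by move=> t; apply: differentiable_continuous; apply: smooth_differentiable; exact: smooth_derive.
have X0 : X t0 = 0 by rewrite /X subrr /dotp /= !mul0r addr0.
have Y0 : Y t0 = 0 by rewrite /Y subrr /dotp /= !mul0r addr0.
have DX0 : 0 < 'D_1 X t0 by rewrite DX dotp_gt0.
have [e /= e0 eX] : \forall e \near 0^'+, forall t, `|t - t0| <= e -> 0 < 'D_1 X t.
  have := cDX t0 _ (lt_nbhsr DX0); rewrite /= nearE => /nbhs_ballP[e /= e0 eP].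
  exists e => //= d; rewrite /ball /= sub0r normrN => de d0 t td.
  apply: eP; rewrite -ball_normE /ball_ /= distrC (le_lt_trans td) //.
  by rewrite -(gtr0_norm d0).
(* The bound [1 / 4] keeps [[t0 + d0, t0 + 1 - d0]] nonempty; this interval contains no translate of
   [t0] by an integer. *)
pose d0 := Num.min (e / 2) (1 / 4).
have d0_gt0 : 0 < d0 by rewrite lt_min !divr_gt0.
have d0_le : d0 <= 1 / 4 by rewrite ge_min lexx orbT.
have d0e : d0 < e by rewrite gt_min ltr_pdivrMr // ltr_pMr // ltr1n.
have Xmono t s : `|t - t0| <= d0 -> `|s - t0| <= d0 -> t < s -> X t < X s.
  rewrite !ler_distl => /andP[t1 t2] /andP[s1 s2] ts.
  apply: (@gtr0_derive1_lt_cc _ X (t0 - d0) (t0 + d0)) => //.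
  - by move=> x _; apply: diff_derivable; exact: smooth_differentiable.
  - move=> x; rewrite in_itv /= => /andP[x1 x2]; rewrite derive1E.
    apply: (eX d0) => //; first by rewrite /ball /= sub0r normrN gtr0_norm.
    by rewrite ler_distl !ltW.
  - by apply: continuous_subspaceT.
  - by rewrite in_itv /= t1 t2.
  - by rewrite in_itv /= s1 s2.
have Xinj t s : `|t - t0| <= d0 -> `|s - t0| <= d0 -> X t = X s -> t = s.
  move=> td sd; case: (ltgtP t s) => // ts e'.
    by have := Xmono _ _ td sd ts; rewrite e' ltxx.
  by have := Xmono _ _ sd td ts; rewrite e' ltxx.
have [r r0 rP] : exists2 r, 0 < r & forall t, t \in `[t0 + d0, t0 + 1 - d0] ->
    `|X t| < r -> `|Y t| < r -> False.
  have cg : {within `[t0 + d0, t0 + 1 - d0], continuous (fun t => X t ^+ 2 + Y t ^+ 2)}.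
    apply: continuous_subspaceT => t; apply: cvgD; rewrite expr2.
      by apply: cvgM; exact: cX.
    by apply: cvgM; exact: cY.
  have [|m mI mP] := EVT_min _ cg; first lra.
  have m0 : 0 < X m ^+ 2 + Y m ^+ 2.
    rewrite lt0r addr_ge0 ?sqr_ge0 // andbT paddr_eq0 ?sqr_ge0 // !sqrf_eq0.
    apply/negP => /andP[/eqP Xm /eqP Ym].
    have cm : c m = c t0.
      apply/eqP; rewrite -subr_eq0; apply/eqP.
      apply: (dotp_coord_inj u0 nurot); first by rewrite -/(X m) Xm /dotp !mul0r addr0.
      by rewrite -/(Y m) Ym /dotp !mul0r addr0.
    have [n mE] := curve_inj cm.
    move: mI; rewrite mE in_itv /= => /andP[n1 n2].
    have n0 : 0 < n%:~R :> R by lra.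
    have n1' : n%:~R < 1 :> R by lra.
    by move: n0 n1'; rewrite ltr0z -[1]/(1%:~R) ltr_int; case: n {mE n1 n2} => [[|n]|n].
  pose M := X m ^+ 2 + Y m ^+ 2.
  (* Since [r <= 1], [|X| < r] and [|Y| < r] would give [X^2 + Y^2 < 2 r <= M], below the minimum
     [M]. *)
  exists (Num.min 1 (M / 2)); first by rewrite lt_min ltr01 divr_gt0.
  set r := Num.min 1 _ => t tI Xr Yr.
  have r1 : r <= 1 by rewrite ge_min lexx.
  have rM : r <= M / 2 by rewrite ge_min lexx orbT.
  have := mP _ tI; rewrite -/M.
  have sq z : `|z| < r -> z ^+ 2 < r.
    move=> zr; rewrite -(real_normK (num_real z)) expr2.
    have z1 : `|z| <= 1 by rewrite (le_trans (ltW zr)).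
    by rewrite (le_lt_trans _ zr) // ler_piMr.
  by have := sq _ Xr; have := sq _ Yr; lra.
have [d [dd0 d_gt0 dY]] : exists d,
    [/\ d <= d0, 0 < d & forall t, `|t - t0| <= d -> `|Y t| < r / 2].
  have : \forall t \near t0, `|Y t| < r / 2.
    have /cvgrPdist_lt := cY t0 => /(_ (r / 2)); rewrite Y0 divr_gt0 // => /(_ isT).
    by apply: filterS => t; rewrite sub0r normrN.
  move=> /nbhs_ballP[e' /= e'0 e'P].
  exists (Num.min d0 (e' / 2)); split; first by rewrite ge_min lexx.
    by rewrite lt_min d0_gt0 divr_gt0.
  move=> t td; apply: e'P; rewrite -ball_normE /ball_ /= distrC (le_lt_trans td) //.
  by rewrite gt_min ltr_pdivrMr // ltr_pMr // ltr1n orbT.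
have dn : `|t0 + d - t0| = d by rewrite addrAC subrr add0r gtr0_norm.
have dn' : `|t0 - d - t0| = d by rewrite addrAC subrr add0r normrN gtr0_norm.
have nt0 : `|t0 - t0| = 0 by rewrite subrr normr0.
have Xd : 0 < X (t0 + d).
  by rewrite -X0; apply: Xmono; rewrite ?dn ?nt0 ?(ltW d0_gt0) // ltrDl.
have Xd' : X (t0 - d) < 0.
  by rewrite -X0; apply: Xmono; rewrite ?dn' ?nt0 ?(ltW d0_gt0) // gtrBl.
pose a := Num.min r (Num.min (X (t0 + d)) (- X (t0 - d))).
have a0 : 0 < a by rewrite !lt_min r0 Xd oppr_gt0.
have ar : a <= r by rewrite ge_min lexx.
have aX : a <= X (t0 + d) by rewrite !ge_min lexx !orbT.
have aX' : a <= - X (t0 - d) by rewrite !ge_min lexx !orbT.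
exists d, a, r; split=> //.
- move=> _ [t _ <-]; rewrite -/(X t) -/(Y t) => Xt Yt.
  (* [t'] is the translate of [t] in [[t0 - d0, t0 + 1 - d0[]. The values from [t0 + d0] on are
     excluded by [rP], and so is the left end, which one period later is [t0 + 1 - d0]. *)
  pose n := Num.floor (t - t0 + d0); pose t' := t - n%:~R.
  have ct' : c t' = c t by rewrite /t' -mulrNz (curve_periodic scc).
  have Xt' : X t' = X t by rewrite /X ct'.
  have Yt' : Y t' = Y t by rewrite /Y ct'.
  have /andP[n1 n2] : t0 - d0 <= t' < t0 + 1 - d0.
    have := fract_itv (t - t0 + d0); rewrite in_itv /= -/n => /andP[n1 n2].
    by apply/andP; rewrite /t'; split; lra.
  have ltd0 : `|t' - t0| < d0.
    rewrite ltr_distl; apply/andP; split.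
      rewrite lt_neqAle n1 andbT; apply/eqP => t'E.
      apply: (rP (t' + 1)); rewrite ?in_itv /=.
      + by rewrite -t'E; apply/andP; split; lra.
      + by rewrite /X -[t' + 1]/(t' + 1%:~R) (curve_periodic scc) -/(X t') Xt'; lra.
      + by rewrite /Y -[t' + 1]/(t' + 1%:~R) (curve_periodic scc) -/(Y t') Yt'.
    rewrite ltNge; apply/negP => h.
    apply: (rP t'); rewrite ?Xt' ?Yt' ?in_itv //=; last lra.
    by rewrite h ltW.
  exists t' => //.
  rewrite ltr_norml in Xt; case/andP: Xt => Xt1 Xt2.
  rewrite ltr_distl !ltNge; apply/andP; split; apply/negP => h.
    have : X t' <= X (t0 - d).
      move: h; rewrite le_eqVlt => /predU1P[->//|h].
      by apply/ltW/Xmono; rewrite ?dn' // ltW.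
    by rewrite Xt'; lra.
  have : X (t0 + d) <= X t'.
    move: h; rewrite le_eqVlt => /predU1P[->//|h].
    by apply/ltW/Xmono; rewrite ?dn // ltW.
  by rewrite Xt'; lra.
- move=> t s td sd; apply: Xinj; exact: le_trans (ltW _) dd0.
- by move=> t td; apply: dY; exact: ltW.
- move=> x; rewrite ltr_norml => /andP[x1 x2].
  have [|||t tI Xtx] := @IVT _ X (t0 - d) (t0 + d) x.
  + by lra.
  + exact: continuous_subspaceT.
  + by rewrite ge_min le_max; apply/andP; split; apply/orP; [left|right]; lra.
  exists t => //; move: tI; rewrite in_itv /= => /andP[t1 t2].
  rewrite ltr_distl; apply/andP; split; rewrite lt_neqAle ?t1 ?t2 andbT;
    apply/eqP => tE; move: Xtx; [rewrite -tE|rewrite tE] => Xtx; lra.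
Qed.

End sides.

(** * Exterior sides and outward normals *)

Section outward_normals.
Context {R : realType}.
Local Notation plane := (R * R)%type.
Implicit Types (p q u v w : plane) (t s : R).
Variables (c : R -> plane) (scc : simple_closed_curve c).

Let smooth_c : smooth c. Proof. by case: scc. Qed.

Let tangent_neq0 t : 'D_1 c t != 0.
Proof. by have [_ _ _] := scc; exact. Qed.

(* Go up to the level [3 r / 4], where there is no curve, then sideways. *)
Lemma graph_box_above t0 nu d a r : graph_box c t0 nu d a r ->
  dotp nu ('D_1 c t0) = 0 -> nu != 0 ->
  forall t q, `|t - t0| < d -> `|dotp (c t - c t0) ('D_1 c t0)| < a ->
    dotp (q - c t0) ('D_1 c t0) = dotp (c t - c t0) ('D_1 c t0) ->
    dotp (c t - c t0) nu < dotp (q - c t0) nu -> dotp (q - c t0) nu < r ->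
  connected_component (~` range c) q (c t0 + (3 / 4 * r / dotp nu nu) *: nu).
Proof.
set u := 'D_1 c t0 => -[[a0 d0 r0] box inj Ybd surj] nuu nu0 t q td Xt Xq Yq Yqr.
have nn := dotp_gt0 nu0.
have unu : dotp u nu = 0 by rewrite dotpC.
pose X p := dotp (p - c t0) u; pose Y p := dotp (p - c t0) nu.
have seg (F := fun w p => dotp (p - c t0) w) w p (s : R) p' :
    F w (p + s *: (p' - p)) = F w p + s * (F w p' - F w p).
  rewrite /F !(dotpBl, dotpDl, dotpZl); ring.
have convex_gt0 A B s : 0 < A -> 0 < B -> 0 <= s -> s <= 1 -> 0 < B + s * (A - B).
  move=> A0 B0 s0 s1; have [AB|AB] := leP A B.
    have : 0 <= (1 - s) * (B - A) by rewrite mulr_ge0 // subr_ge0.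
    lra.
  have : 0 <= s * (A - B) by rewrite mulr_ge0 // subr_ge0 ltW.
  lra.
have /andP[Yt1 Yt2] : - (r / 2) < Y (c t) < r / 2 by rewrite -ltr_norml; exact: Ybd.
pose q1 := q + ((3 / 4 * r - Y q) / dotp nu nu) *: nu.
have Xq1 : X q1 = X q.
  rewrite /X /q1 !(dotpBl, dotpDl, dotpZl) nuu; ring.
have Yq1 : Y q1 = 3 / 4 * r.
  rewrite /q1 {1}/Y !(dotpBl, dotpDl, dotpZl) divfK ?lt0r_neq0 //.
  rewrite /Y dotpBl; ring.
set Q := c t0 + _.
have XQ : X Q = 0 by rewrite /X /Q !(dotpBl, dotpDl, dotpZl) nuu; ring.
have YQ : Y Q = 3 / 4 * r.
  rewrite /Y /Q !(dotpBl, dotpDl, dotpZl) divfK ?lt0r_neq0 //; ring.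
apply: (@connected_component_trans _ _ q1).
  apply: segment_component => s /andP[s0 s1] rz.
  set z := q + _ in rz.
  have Xz : X z = X (c t) by rewrite {1}/X /z seg -/(X q) -/(X q1) Xq1 subrr mulr0 addr0 /X Xq.
  have Yz : Y z = Y q + s * (3 / 4 * r - Y q) by rewrite /Y /z seg -/(Y q) -/(Y q1) Yq1.
  have Yz1 : Y (c t) < Y z.
    have A0 : 0 < 3 / 4 * r - Y (c t) by lra.
    have B0 : 0 < Y q - Y (c t) by rewrite subr_gt0.
    have := convex_gt0 _ _ _ A0 B0 s0 s1; rewrite Yz; lra.
  have Yz2 : Y z < r.
    have A0 : 0 < r - 3 / 4 * r by lra.
    have B0 : 0 < r - Y q by rewrite subr_gt0.
    have := convex_gt0 _ _ _ A0 B0 s0 s1; rewrite Yz; lra.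
  have [||t' t'd ct'] := box z rz.
  + by rewrite -/(X z) Xz.
  + by rewrite -/(Y z) ltr_norml Yz2 andbT; lra.
  have tt' : t' = t by apply: inj => //; rewrite ct' -/(X z) Xz.
  by move: Yz1; rewrite -ct' tt' ltxx.
apply: segment_component => s /andP[s0 s1] rz.
set z := q1 + _ in rz.
have Xz : X z = (1 - s) * X q.
  rewrite {1}/X /z seg -/(X q1) -/(X Q) Xq1 XQ; ring.
have Yz : Y z = 3 / 4 * r by rewrite /Y /z seg -/(Y q1) -/(Y Q) Yq1 YQ subrr mulr0 addr0.
have [||t' t'd ct'] := box z rz.
+ rewrite -/(X z) Xz normrM (le_lt_trans _ Xt) // {1}/X Xq ler_piMl //.
  by rewrite ger0_norm; lra.
+ by rewrite -/(Y z) Yz ger0_norm; lra.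
have := Ybd _ t'd; rewrite ct' -/(Y z) Yz ger0_norm; lra.
Qed.

Let cX w p : continuous (fun t => dotp (c t - p) w).
Proof.
move=> t; apply: differentiable_continuous; apply: smooth_differentiable.
by have [] := smooth_dotp p w smooth_c.
Qed.

Lemma near_box t0 (w : plane) (a : R) : 0 < a ->
  \forall t \near t0, `|dotp (c t - c t0) w| < a.
Proof.
move=> a0; have /cvgrPdist_lt := @cX w (c t0) t0 => /(_ _ a0).
apply: filterS => t; rewrite subrr [dotp 0 w](_ : _ = 0) ?sub0r ?normrN //.
by rewrite /dotp !mul0r addr0.
Qed.

(** In a graph box a point off the curve lies strictly above or strictly below the graph, and the
    points of one side are joined to each other off the curve. One exterior point close to [c t0]
    therefore makes its whole side exterior. *)
Lemma exterior_side t0 : closure (exterior_of c) (c t0) ->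
  exists nu : plane, [/\ dotp nu ('D_1 c t0) = 0, nu != 0 &
    \forall t \near t0, \forall s \near 0^'+, exterior_of c (c t + s *: nu)].
Proof.
set u := 'D_1 c t0 => clE.
have u0 : u != 0 by exact: tangent_neq0.
have side nu d a r : graph_box c t0 nu d a r -> dotp nu u = 0 -> nu != 0 ->
    (exists t q, [/\ exterior_of c q, `|t - t0| < d,
       `|dotp (c t - c t0) u| < a,
       dotp (c t - c t0) nu < dotp (q - c t0) nu /\ dotp (q - c t0) nu < r &
       dotp (q - c t0) u = dotp (c t - c t0) u]) ->
    \forall t \near t0, \forall s \near 0^'+, exterior_of c (c t + s *: nu).
  move=> gb nuu nu0 [t [q [Eq td Xt [Yq1 Yq2] Xq]]].
  have above := graph_box_above gb nuu nu0.
  have EQ := exterior_component (above _ _ td Xt Xq Yq1 Yq2) Eq.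
  have [[a0 d0 r0] _ _ Ybd _] := gb; have nn := dotp_gt0 nu0.
  near=> t'.
  have t'd : `|t' - t0| < d.
    near: t'; have := @nbhsx_ballx _ _ t0 _ d0.
    by apply: filterS => y; rewrite -ball_normE /ball_ /= distrC.
  have Xt' : `|dotp (c t' - c t0) u| < a by near: t'; exact: near_box.
  near=> s.
  have s0 : 0 < s by near: s; exact: nbhs_right_gt.
  have sr : s * dotp nu nu < r / 2.
    by rewrite -ltr_pdivlMr //; near: s; apply: nbhs_right_lt; rewrite !divr_gt0.
  apply: exterior_component EQ; apply: connected_component_sym.
  have /andP[_ Yt'] : - (r / 2) < dotp (c t' - c t0) nu < r / 2.
    by rewrite -ltr_norml; exact: Ybd.
  have Ynew : dotp (c t' + s *: nu - c t0) nu = dotp (c t' - c t0) nu + s * dotp nu nu.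
    by rewrite !(dotpBl, dotpDl, dotpZl); ring.
  apply: (above t') => //.
  - by rewrite !(dotpBl, dotpDl, dotpZl) nuu; ring.
  - by rewrite Ynew ltrDl mulr_gt0.
  - by rewrite Ynew; lra.
pose nu := rotp u.
have nuu : dotp nu u = 0 by rewrite /nu /dotp /=; ring.
have nu0 : nu != 0.
  by have := u0; rewrite /nu !xpair_eqE /= oppr_eq0 andbC.
have [d [a [r gb]]] := graph_box_exists scc nuu nu0 (or_introl erefl).
have [[a0 d0 r0] box inj Ybd surj] := gb.
have [|q [Eq /= [Xq Yq]]] := clE [set q | `|dotp (q - c t0) u| < a /\ `|dotp (q - c t0) nu| < r].
  have z w : dotp (c t0 - c t0) w = 0 by rewrite subrr /dotp /= !mul0r addr0.
  apply: filterI.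
    have /cvgrPdist_lt := @dotp_continuous _ (c t0) u (c t0) => /(_ _ a0).
    by apply: filterS => q; rewrite z sub0r normrN.
  have /cvgrPdist_lt := @dotp_continuous _ (c t0) nu (c t0) => /(_ _ r0).
  by apply: filterS => q; rewrite z sub0r normrN.
have [t td Xt] := surj _ Xq.
have Xta : `|dotp (c t - c t0) u| < a by rewrite Xt.
case: (ltgtP (dotp (q - c t0) nu) (dotp (c t - c t0) nu)) => Yqt.
- have Nnu p : dotp p (- nu) = - dotp p nu by rewrite /dotp /=; ring.
  have nuuN : dotp (- nu) u = 0 by rewrite dotpC Nnu dotpC nuu oppr0.
  have nu0N : - nu != 0 by rewrite oppr_eq0.
  exists (- nu); split=> //; apply: side (graph_boxN gb) _ _ _ => //.
  exists t, q; split=> //; rewrite !Nnu ltrN2; split=> //.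
  by move: Yq; rewrite ltr_norml => /andP[]; lra.
- exists nu; split=> //; apply: side gb _ _ _ => //.
  exists t, q; split=> //; split=> //.
  by move: Yq; rewrite ltr_norml => /andP[].
- exfalso; have [nrq _] := Eq; apply: nrq; exists t => //.
  have := dotp_coord_inj u0 (or_introl erefl) Xt (esym Yqt) => e.
  by rewrite -(subrK (c t0) (c t)) e subrK.
Unshelve. all: by end_near. Qed.

(* The set of such parameters is closed, open by [exterior_side], and contains
   the parameter of a rightmost point of the curve. *)
Lemma closure_exterior_curve t : closure (exterior_of c) (c t).
Proof.
pose T := [set t | closure (exterior_of c) (c t)].
suff TT : T = setT by rewrite -[closure _ _]/(T t) TT.
have cR : connected [set: R] by apply/connected_intervalP => x y z.
apply: cR.
- have cf : {within `[0, 1], continuous (fst \o c)}.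
    apply: continuous_subspaceT => s; apply: continuous_comp.
      exact: (curve_continuous scc).
    exact: cvg_fst.
  have [|m _ mP] := EVT_max _ cf; first exact: ler01.
  have cm s : (c s).1 <= (c m).1.
    rewrite (curve_fract scc); apply: (mP (s - (Num.floor s)%:~R)); have := fract_itv s.
    by rewrite !in_itv /= => /andP[-> /ltW ->].
  exists m => B /nbhs_ballP[e /= e0 eB].
  have fstE (x : plane) a : (x + a *: ((1, 0) : plane)).1 = x.1 + a.
    by rewrite /= [_%:A]mulr1.
  pose q : plane := c m + (e / 2) *: (1, 0).
  exists q; split.
    have ray (s : R) : 0 <= s -> (~` range c) (q + s *: (1, 0)).
      move=> s0 [t' _ ct']; have := cm t'.
      by rewrite ct' !fstE; lra.
    split; first by have := ray 0 (lexx _); rewrite scale0r addr0.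
    apply: (@ray_component_unbounded _ _ _ q (1, 0)) => //.
    by rewrite xpair_eqE oner_eq0.
  apply: eB; rewrite -ball_normE /ball_ /= /q opprD addNKr normrN normrZ.
  rewrite gtr0_norm ?divr_gt0 // plane_normE /= normr1 normr0.
  rewrite (_ : Num.max 1 0 = 1); last by apply/max_idPl.
  by rewrite mulr1 ltr_pdivrMr // ltr_pMr // ltr1n.
- exists T; last by rewrite setTI.
  rewrite openE => t0 /exterior_side[nu [_ nu0]].
  apply: filterS => t1 Et1 B nB.
  have ct : (c t1 + s *: nu) @[s --> 0^'+] --> c t1.
    rewrite -[X in _ --> X]addr0; apply: cvgD; first exact: cvg_cst.
    rewrite -[X in _ --> X](scale0r nu); apply: cvgZl.
    by apply: cvg_at_right_filter; exact: cvg_id.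
  have BE : \forall s \near 0^'+, (exterior_of c `&` B) (c t1 + s *: nu).
    by near=> s; split; near: s => //; exact: ct.
  by have [s sP] := filter_ex BE; exists (c t1 + s *: nu).
- exists T; last by rewrite setTI.
  rewrite (_ : T = c @^-1` closure (exterior_of c)) //.
  apply: closed_comp; last exact: closed_closure.
  by move=> s _; exact: (curve_continuous scc).
Unshelve. all: by end_near. Qed.

(** The sign condition in [extends_ribbon] ranges over all outward normals at a node, so it yields
    an ascent direction only once a normal exists. *)
Lemma outward_normal_exists t : exists n, outward_normal c t n.
Proof.
have [nu [nuu nu0 En]] := exterior_side (@closure_exterior_curve t).
have nn := dotp_gt0 nu0.
pose k := (Num.sqrt (dotp nu nu))^-1.
have k0 : 0 < k by rewrite invr_gt0 sqrtr_gt0.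
exists (k *: nu); split.
- rewrite dotpZl dotpC dotpZl mulrA -expr2 /k exprVn sqr_sqrtr ?ltW //.
  by rewrite mulVf ?lt0r_neq0.
- by rewrite dotpZl nuu mulr0.
- have /= := nbhs_singleton En.
  rewrite !nearE => /nbhs_ballP [e /= e0 eE].
  apply/nbhs_ballP; exists (e / k); first by rewrite /= divr_gt0.
  move=> s; rewrite /ball /= sub0r normrN => se s0.
  rewrite scalerA; apply: exteriorNclosure => //.
  apply: eE; last by rewrite mulr_gt0.
  by rewrite /ball /= sub0r normrN normrM (gtr0_norm k0) -ltr_pdivlMr.
Qed.

End outward_normals.

(** * Directional derivatives in the plane *)

Section plane_calculus.
Context {R : realType}.
Local Notation plane := (R * R)%type.
Implicit Types (f g : plane -> R) (v w x y : plane).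

Lemma smooth_continuous (V W : normedModType R) (f : V -> W) : smooth f -> continuous f.
Proof. by move=> sf x; apply: differentiable_continuous; exact: smooth_differentiable. Qed.

Lemma directional_derive f v x : smooth f ->
  'D_v f x = v.1 * 'D_(1, 0) f x + v.2 * 'D_(0, 1) f x.
Proof.
move=> sf; rewrite !deriveE; try exact: smooth_differentiable.
rewrite {1}(_ : v = v.1 *: (1, 0) + v.2 *: (0, 1)).
  by rewrite linearD !linearZ.
rewrite [LHS]surjective_pairing [RHS]surjective_pairing /= /GRing.scale /=.
by rewrite !mulr1 !mulr0 addr0 add0r.
Qed.

Lemma directional_deriveZ f (a : R) v x : smooth f -> 'D_(a *: v) f x = a * 'D_v f x.
Proof.
by move=> sf; rewrite !deriveE ?linearZ //; exact: smooth_differentiable.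
Qed.

Lemma chain_rule_curve f (c : R -> plane) t :
  smooth f -> differentiable c t -> 'D_1 (f \o c) t = 'D_('D_1 c t) f (c t).
Proof.
move=> sf dc; have df := smooth_differentiable sf (c t).
rewrite deriveE; last exact: differentiable_comp.
rewrite diff_comp //= [RHS]deriveE //; congr ('d f _ _).
by rewrite deriveE.
Qed.

Lemma norm_fst x : `|x.1| <= `|x|.
Proof. by rewrite plane_normE le_max lexx. Qed.

Lemma norm_snd x : `|x.2| <= `|x|.
Proof. by rewrite plane_normE le_max lexx orbT. Qed.

Lemma box_compact (r : R) : compact [set x : plane | `|x| <= r].
Proof.
rewrite (_ : mkset _ = `[(- r), r]%classic `*` `[(- r), r]%classic).
  by apply: compact_setX; exact: segment_compact.
apply/seteqP; split=> [x /=|x /= []]; rewrite !in_itv /= -!ler_norml plane_normE ge_max.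
  by move=> /andP.
by move=> -> ->.
Qed.

Lemma continuous_bounded_box f r : continuous f ->
  exists2 C : R, 0 <= C & forall x, `|x| <= r -> `|f x| <= C.
Proof.
move=> cf; have [M [_ bM]] : bounded_set (f @` [set x : plane | `|x| <= r]).
  apply: compact_bounded; apply: continuous_compact; last exact: box_compact.
  exact: continuous_subspaceT.
exists (`|M| + 1); first by rewrite addr_ge0.
move=> x xr; apply: (bM (`|M| + 1)); last by exists x.
by rewrite (le_lt_trans (ler_norm _)) // ltrDl.
Qed.

Lemma derive_bounded_box f r : smooth f ->
  exists2 C : R, 0 <= C & forall x w, `|x| <= r -> `|'D_w f x| <= C * `|w|.
Proof.
move=> sf.
have cD v : continuous ('D_v f) by apply: smooth_continuous; exact: smooth_derive.
have [C1 C1_ge0 C1P] := continuous_bounded_box r (cD (1, 0)).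
have [C2 C2_ge0 C2P] := continuous_bounded_box r (cD (0, 1)).
exists (C1 + C2); first exact: addr_ge0.
move=> x w xr; rewrite directional_derive // (le_trans (ler_normD _ _)) // !normrM mulrDl.
apply: lerD; rewrite mulrC ler_pM //; [exact: C1P|exact: norm_fst|exact: C2P|exact: norm_snd].
Qed.

Lemma lipschitz_box f r : smooth f ->
  exists2 C : R, 0 <= C & forall x y, `|x| <= r -> `|y| <= r ->
    `|f x - f y| <= C * `|x - y|.
Proof.
move=> sf; have [C C0 CP] := derive_bounded_box r sf; exists C => // x y xr yr.
pose g (s : R) : plane := y + s *: (x - y).
have dg (s : R) : is_derive s 1 (g : R -> plane) (x - y).
  have dZ : is_derive s 1 (fun s : R => s *: (x - y) : plane) (x - y).
    apply: DeriveDef.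
      by apply/derivable1_diffP; exact: ex_diff.
    rewrite deriveE; last exact: ex_diff.
    by rewrite diff_val scale1r.
  have dY := @is_derive_cst _ _ _ y s 1.
  have := @is_deriveD _ _ _ _ _ _ _ _ _ dY dZ.
  by rewrite add0r.
have dgf (s : R) : differentiable g s by apply/derivable1_diffP; exact: ex_derive.
have dfg (s : R) : is_derive s 1 (f \o g) ('D_(x - y) f (g s)).
  apply: DeriveDef.
    apply/derivable1_diffP; apply: differentiable_comp => //.
    exact: smooth_differentiable.
  by rewrite chain_rule_curve // derive_val.
have [|s sI] := @MVT R (f \o g) (fun s => 'D_(x - y) f (g s)) 0 1 ltr01 (fun s _ => dfg s).
  apply: continuous_subspaceT => s; apply: differentiable_continuous.
  by apply: differentiable_comp => //; exact: smooth_differentiable.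
rewrite /= /g scale1r scale0r addr0 subrKC subr0 mulr1 => ->.
apply: CP; move: sI; rewrite in_itv /= => /andP[/ltW s0 /ltW s1].
rewrite (_ : y + _ = (1 - s) *: y + s *: x); last first.
  by rewrite scalerBr scalerBl scale1r addrA addrAC.
rewrite (le_trans (ler_normD _ _)) // !normrZ !ger0_norm ?subr_ge0 //.
have := ler_wpM2l s0 xr; have s1' : 0 <= 1 - s by rewrite subr_ge0.
have := ler_wpM2l s1' yr; lra.
Qed.

Lemma near_eq_crit f g x : (\forall y \near x, f y = g y) -> crit f x -> crit g x.
Proof. by move=> fg cf v; rewrite -(near_eq_derive _ fg). Qed.

End plane_calculus.

(** * A collar in which [f] and [F] ascend together *)

Section collar.
Context {R : realType}.
Local Notation plane := (R * R)%type.
Implicit Types (f F G : plane -> R) (v w x y : plane).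
Variables (f : plane -> R) (c : R -> plane).
Hypotheses (sf : smooth f) (scc : simple_closed_curve c) (gen : generic f c).

Let sc : smooth c. Proof. by case: scc. Qed.

(** Tangent and normal span the plane, and the tangential derivative vanishes at a node. A vanishing
    normal derivative would make the node a critical point of [f] on the curve, which [generic]
    excludes. *)
Lemma node_normal_neq0 t n : node f c t -> outward_normal c t n -> 'D_n f (c t) != 0.
Proof.
move=> [_ nt] [nn ntau _]; apply/eqP => Dn.
have [disj _ _] := gen.
suff : (range c `&` crit f) (c t) by rewrite disj.
split; first by exists t.
set u := 'D_1 c t.
have u0 : u != 0 by have [_ _ _] := scc; exact.
have Du : 'D_u f (c t) = 0.
  by rewrite -nt derive1E chain_rule_curve //; exact: smooth_differentiable.
have := dotp_gt0 u0; set d := dotp u u => d0 v.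
rewrite directional_derive //.
rewrite directional_derive // in Du; rewrite directional_derive // in Dn.
set A := 'D_(1, 0) f (c t) in Du Dn *; set B := 'D_(0, 1) f (c t) in Du Dn *.
rewrite -/u in ntau.
have det0 : u.1 * n.2 - u.2 * n.1 != 0.
  apply/eqP => det0.
  (* Lagrange's identity. *)
  have : d * dotp n n = dotp n u ^+ 2 + (u.1 * n.2 - u.2 * n.1) ^+ 2.
    by rewrite /d /dotp; ring.
  by rewrite ntau det0 nn; move: d0; lra.
have A0 : (u.1 * n.2 - u.2 * n.1) * A = 0.
  transitivity (n.2 * (u.1 * A + u.2 * B) - u.2 * (n.1 * A + n.2 * B)); first ring.
  by rewrite Du Dn !mulr0 subr0.
have B0 : (u.1 * n.2 - u.2 * n.1) * B = 0.
  transitivity (u.1 * (n.1 * A + n.2 * B) - n.1 * (u.1 * A + u.2 * B)); first ring.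
  by rewrite Du Dn !mulr0 subr0.
have /eqP -> : A == 0 by move/eqP: A0; rewrite mulf_eq0 (negbTE det0).
have /eqP -> : B == 0 by move/eqP: B0; rewrite mulf_eq0 (negbTE det0).
by rewrite !mulr0 addr0.
Qed.

Lemma extends_ribbon_near G : smooth G ->
  (forall t, \forall y \near c t, G y = f y) -> extends_ribbon f c G.
Proof.
move=> sG Gf; split=> // [t|t n nt no]; first exact: (nbhs_singleton (Gf t)).
by rewrite (near_eq_derive _ (Gf t)); split => //; exact: node_normal_neq0 nt no.
Qed.

(* At a point which is not a node the tangent serves, at a node the outward
   normal. *)
Lemma common_ascent F t : extends_ribbon f c F ->
  exists w, 0 < 'D_w f (c t) /\ 0 < 'D_w F (c t).
Proof.
move=> [sF Ff Fn]; rewrite (curve_fract scc); set s := t - _.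
have dc : differentiable c s by exact: smooth_differentiable.
have Dtau : 'D_('D_1 c s) F (c s) = 'D_('D_1 c s) f (c s).
  rewrite -!chain_rule_curve //; congr ('D_1 _ s).
  by apply/funext => y; exact: Ff.
have [D0|D0] := eqVneq ('D_('D_1 c s) f (c s)) 0.
  have [n no] := outward_normal_exists scc s.
  have ns : node f c s by split; [exact: fract_itv|rewrite derive1E chain_rule_curve].
  have [DnF sgD] := Fn _ _ ns no.
  exists ('D_n F (c s) *: n); rewrite !directional_deriveZ //.
  split; last by rewrite -expr2 exprn_even_gt0.
  by rewrite -sgr_gt0 sgrM -sgD -expr2 exprn_even_gt0 //= sgr_eq0.
exists ('D_('D_1 c s) f (c s) *: 'D_1 c s).
by rewrite !directional_deriveZ // Dtau -!expr2 !exprn_even_gt0.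
Qed.

(** Ascent in a fixed direction [w] is an open condition, so compactness of the curve gives one [m]
    for all its points. The same [m] bounds the slopes from below and, through [m^-1], the length of
    [w] from above. The cutoff may differ from 1 only where such a [w] exists. *)
Lemma collar F : extends_ribbon f c F -> exists (m : R) (chi : plane -> R),
  [/\ 0 < m, smooth chi, forall x, 0 <= chi x <= 1,
      forall t, \forall y \near c t, chi y = 0 &
      forall x, (\forall y \near x, chi y = 1) \/
        exists w, [/\ `|w| <= m^-1, m < 'D_w f x & m < 'D_w F x]].
Proof.
move=> ext; have [sF _ _] := ext.
have cD g w : smooth g -> continuous ('D_w g : plane -> R).
  by move=> sg; apply: smooth_continuous; exact: smooth_derive.
pose P m x := exists w, [/\ `|w| <= m^-1, m < 'D_w f x & m < 'D_w F x].
have /compact_near_coveringP cov := curve_compact scc.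
have : \forall m \near 0^'+, range c `<=` P m.
  apply: cov => _ [t _ <-].
  have [w [wf wF]] := common_ascent t ext.
  pose k := Num.min (Num.min ('D_w f (c t) / 2) ('D_w F (c t) / 2)) ((`|w| + 1)^-1).
  have w1 : 0 < `|w| + 1 by rewrite ltr_wpDl.
  have k0 : 0 < k by rewrite !lt_min !divr_gt0 //= invr_gt0.
  exists ([set x | 'D_w f (c t) / 2 < 'D_w f x /\ 'D_w F (c t) / 2 < 'D_w F x],
          [set m | 0 < m < k]) => /=.
    split.
      apply: filterI; [apply: (cD _ w sf (c t) [set z | _ < z])|
                       apply: (cD _ w sF (c t) [set z | _ < z])]; apply: lt_nbhsr; lra.
    near=> m; apply/andP; split; near: m; [exact: nbhs_right_gt|exact: nbhs_right_lt].
  move=> [x m] /= [[x1 x2] /andP[m0]]; rewrite !lt_min => /andP[/andP[m1 m2] m3].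
  exists w; split; [|exact: lt_trans x1|exact: lt_trans x2].
  rewrite -[m^-1]mul1r ler_pdivlMr //.
  by move: m3; rewrite -[_^-1]mul1r ltr_pdivlMr // mulrDr mulr1 mulrC; lra.
move=> near_m.
have [m [m0 Pm]] : exists m, 0 < m /\ range c `<=` P m.
  have near_m' : \forall m \near 0^'+, 0 < m /\ range c `<=` P m.
    by near=> m; split; near: m => //; exact: nbhs_right_gt.
  by have [m] := filter_ex near_m'; exists m.
have PO x : range c x -> nbhs x (P m).
  move=> /Pm[w [w1 w2 w3]].
  have nf : \forall y \near x, m < 'D_w f y by exact: (cD _ w sf x _ (lt_nbhsr w2)).
  have nF : \forall y \near x, m < 'D_w F y by exact: (cD _ w sF x _ (lt_nbhsr w3)).
  by near=> y; exists w; split=> //; near: y.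
have [chi [schi chi01 chi0 chi1]] := smooth_urysohn (curve_compact scc) PO.
exists m, chi; split=> // [t|x]; first by apply: chi0; exists t.
by have [|] := pselect (P m x); [right|left; exact: chi1].
Unshelve. all: by end_near. Qed.

End collar.

(** * Gluing and perturbing ribbon extensions *)

Section glue.
Context {R : realType}.
Local Notation plane := (R * R)%type.
Implicit Types (f F G : plane -> R) (v w x y : plane).
Variables (f : plane -> R) (c : R -> plane).
Hypotheses (sf : smooth f) (scc : simple_closed_curve c) (gen : generic f c).

(* Inside the curve [G = f + chi u + (1 - chi) phi u] with [u = F - f], where
   [phi] vanishes near 0, has slope in [0, 1] and is uniformly close to the
   identity. Up to the small term [(u - phi u) grad chi], the gradient of [G]
   is a convex combination of those of [f] and [F]. *)
Lemma ribbon_glue F : extends_ribbon f c F -> exists G,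
  [/\ smooth G,
      forall x, ~ interior_of c x -> \forall y \near x, G y = f y &
      forall x, interior_of c x -> crit G x -> crit F x].
Proof.
move=> ext; have [sF Ff _] := ext.
have [m [chi [m0 schi chi01 chi0 chi1]]] := collar sf scc ext.
have [r r0 rP] := interior_bounded scc.
have [C C0 CP] := derive_bounded_box r schi.
(* With [|w| <= m^-1] the error term is at most [2 e C / m = m C / (C + 1)], hence less than the
   common ascent [m]. *)
pose e := m * m / (2 * (C + 1)).
have C1 : 0 < C + 1 by rewrite ltr_wpDl.
have e0 : 0 < e by rewrite divr_gt0 ?mulr_gt0.
have [phi [sphi phi0 phi01 phie]] := smooth_threshold e0.
pose u x := F x - f x.
have su : smooth u by exact: smoothB.
pose nchi x := 1 - chi x.
have snchi : smooth nchi by apply: smoothB => //; exact: smooth_cst.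
have spu : smooth (phi \o u) by exact: smooth_comp.
pose H := f \+ (chi \* u \+ nchi \* (phi \o u)).
have s1 : smooth (chi \* u) by exact: smoothM.
have s2 : smooth (nchi \* (phi \o u)) by exact: smoothM.
have s12 : smooth (chi \* u \+ nchi \* (phi \o u)) by exact: smoothD.
have sH : smooth H by exact: smoothD.
pose G x := if `[< interior_of c x >] then H x else f x.
have Hc t : \forall y \near c t, H y = f y.
  have cu : continuous u by exact: smooth_continuous.
  have /cvgrPdist_le := cu (c t) => /(_ e e0).
  have uct : u (c t) = 0 by rewrite /u Ff subrr.
  rewrite uct => uy.
  near=> y.
  have -> : H y = f y + (chi y * u y + nchi y * phi (u y)) by [].
  have -> : chi y = 0 by near: y; exact: chi0.
  rewrite phi0 ?mul0r ?mulr0 ?addr0 // -normrN -sub0r.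
  by near: y; exact: uy.
have Gf x : ~ interior_of c x -> \forall y \near x, G y = f y.
  have [ix|[t _ <-]|ex _] := curve_trichotomy c x; first by [].
    by move=> _; apply: filterS (Hc t) => y Hy; rewrite /G; case: ifP.
  have : nbhs x (exterior_of c) by have := exterior_open scc; rewrite openE; exact.
  apply: filterS => y ey; rewrite /G asboolF // => iy; exact: interiorNexterior iy ey.
have GH x : interior_of c x -> \forall y \near x, G y = H y.
  move=> ix.
  have : nbhs x (interior_of c) by have := interior_open scc; rewrite openE; exact.
  by apply: filterS => y iy; rewrite /G asboolT.
exists G; split=> //.
  apply: smooth_local => x; have [ix|nix] := pselect (interior_of c x).
    by exists H => //; exact: GH.
  by exists f => //; exact: Gf.
move=> x ix /(near_eq_crit (GH _ ix)) cH.
have [chix|[w [wm wf wF]]] := chi1 x.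
  apply: near_eq_crit cH; near=> y.
  have -> : H y = f y + (chi y * u y + nchi y * phi (u y)) by [].
  have chiy : chi y = 1 by near: y.
  by rewrite /nchi chiy subrr mul0r addr0 mul1r /u addrC subrK.
exfalso; have := cH w.
have xr : `|x| <= r by apply: rP; exact: subset_closure.
rewrite smooth_deriveD // smooth_deriveD // !smooth_deriveM //.
have -> : 'D_w nchi x = - 'D_w chi x.
  rewrite (smooth_deriveB (f := cst 1)) ?derive_cst ?sub0r //.
  exact: smooth_cst.
rewrite derive_comp; try exact: smooth_differentiable.
have -> : 'D_w u x = 'D_w F x - 'D_w f x by exact: smooth_deriveB.
rewrite /=.
set a := 'D_w f x in wf *; set b := 'D_w F x in wF *.
set d := 'D_w chi x; set p := 'D_1 phi (u x).
have /andP[p0 p1] : 0 <= p <= 1 by exact: phi01.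
have /andP[x0 x1] := chi01 x.
(* The weight of the gradient of [F] in that of [H], up to the error term; the gradient of [f] has
   weight [1 - s]. *)
pose s := chi x + nchi x * p.
have s0 : 0 <= s by rewrite addr_ge0 ?mulr_ge0 // subr_ge0.
have s1' : s <= 1.
  have : nchi x * p <= nchi x * 1 by rewrite ler_wpM2l // subr_ge0.
  by rewrite /s /nchi; lra.
have err : `|(u x - phi (u x)) * d| < m.
  have dC : `|d| <= C * m^-1 by rewrite (le_trans (CP _ _ xr)) // ler_wpM2l.
  have : `|(u x - phi (u x)) * d| <= 2 * e * (C * m^-1).
    by rewrite normrM ler_pM.
  move/le_lt_trans; apply.
  rewrite /e (_ : _ * _ = m * (C / (C + 1))); last by field; rewrite !lt0r_neq0.
  by rewrite gtr_pMr // ltr_pdivrMr // mul1r ltrDl.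
move: err; rewrite ltr_norml => /andP[err _].
have ha : 0 <= (1 - s) * (a - m) by rewrite mulr_ge0 // subr_ge0 // ltW.
have hb : 0 <= s * (b - m) by rewrite mulr_ge0 // subr_ge0 ltW.
have -> : a + (chi x * (b - a) + u x * d + (nchi x * (p * (b - a)) + phi (u x) * - d)) =
   (1 - s) * (a - m) + s * (b - m) + (m + (u x - phi (u x)) * d).
  by rewrite /s /nchi; ring.
lra.
Unshelve. all: by end_near. Qed.

(** The collar is taken with [F = f], and [e] does not depend on [a1] and [a2]. This leaves a whole
    square of gradient values, a set of positive measure, from which to pick a finite fiber. *)
Lemma ribbon_perturb : exists r e : R, [/\ 0 <= r, 0 < e & forall a1 a2 : R,
  `|a1| <= e -> `|a2| <= e -> exists2 F, extends_ribbon f c F &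
    closure (interior_of c) `&` crit F `<=`
    [set x | [/\ `|x| <= r, 'D_(1, 0) f x = a1 & 'D_(0, 1) f x = a2]]].
Proof.
have ext : extends_ribbon f c f.
  by split=> // t n nt no; split => //; exact: (node_normal_neq0 sf scc gen nt no).
have [m [chi [m0 schi chi01 chi0 chi1]]] := collar sf scc ext.
have [r r0 rP] := interior_bounded scc.
have [C C0 CP] := derive_bounded_box r schi.
have rC : 0 < 1 + r * C by rewrite ltr_pwDl // mulr_ge0.
(* In the collar the derivative of [chi l] along [w] is at most [2 e / m + 2 e r C / m = m / 2], too
   small to cancel that of [f], which exceeds [m]. *)
pose e := m * m / (4 * (1 + r * C)).
have e0 : 0 < e by rewrite divr_gt0 ?mulr_gt0.
exists r, e; split=> // a1 a2 a1e a2e.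
pose l (x : plane) := a1 * x.1 + a2 * x.2.
have sl : smooth l.
  apply: smoothD; apply: smoothMl; [exact: smooth_fst|exact: smooth_snd].
have Dl w x : 'D_w l x = l w.
  have d1 : 'D_w (fst : plane -> R) x = w.1.
    rewrite deriveE; last by apply: smooth_differentiable; exact: smooth_fst.
    by rewrite diff_lin // => y; exact: cvg_fst.
  have d2 : 'D_w (snd : plane -> R) x = w.2.
    rewrite deriveE; last by apply: smooth_differentiable; exact: smooth_snd.
    by rewrite diff_lin // => y; exact: cvg_snd.
  have -> : l = cst a1 \* fst \+ cst a2 \* snd by [].
  rewrite smooth_deriveD ?smooth_deriveM ?derive_cst ?d1 ?d2 ?mulr0 ?addr0 //;
   by do ?apply: smoothM; do ?[exact: smooth_cst|exact: smooth_fst|exact: smooth_snd].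
have lb x : `|l x| <= 2 * e * `|x|.
  rewrite /l (le_trans (ler_normD _ _)) // !normrM.
  have h1 : `|a1| * `|x.1| <= e * `|x| by rewrite ler_pM // norm_fst.
  have h2 : `|a2| * `|x.2| <= e * `|x| by rewrite ler_pM // norm_snd.
  lra.
have scl : smooth (chi \* l) by exact: smoothM.
pose F := fun x => f x - (chi \* l) x.
have sF : smooth F by exact: smoothB.
exists F.
  apply: extends_ribbon_near => // t; apply: filterS (chi0 t) => y chiy.
  by rewrite /F /= chiy mul0r subr0.
move=> x [/rP xr cF].
have DF w : 'D_w F x = 'D_w f x - (chi x * l w + l x * 'D_w chi x).
  by rewrite smooth_deriveB // smooth_deriveM // Dl.
have [chix|[w [wm wf _]]] := chi1 x.
  have Dchi w : 'D_w chi x = 0.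
    rewrite (@near_eq_derive R plane R chi (cst 1)) ?derive_cst //.
  have Df w : 'D_w f x = l w.
    by have := cF w; rewrite DF Dchi (nbhs_singleton chix); lra.
  by split=> //; rewrite Df /l /=; lra.
exfalso; have := cF w; rewrite DF.
have /andP[x0 x1] := chi01 x.
have b1 : `|chi x * l w| <= 2 * e * m^-1.
  rewrite normrM ger0_norm // (le_trans (ler_piMl _ x1)) // (le_trans (lb w)) //.
  by rewrite ler_wpM2l // mulr_ge0 // ltW.
have b2 : `|l x * 'D_w chi x| <= 2 * e * r * (C * m^-1).
  rewrite normrM ler_pM // ?(le_trans (lb x)) ?(le_trans (CP _ _ xr)) //.
    by rewrite ler_wpM2l // mulr_ge0 // ltW.
  by rewrite ler_wpM2l.
have bm : 2 * e * m^-1 + 2 * e * r * (C * m^-1) = m / 2.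
  by rewrite /e; field; rewrite !lt0r_neq0.
move: b1 b2; rewrite !ler_norml => /andP[_ b1] /andP[_ b2]; lra.
Qed.

End glue.

(** * Lipschitz maps of the plane have finite fibers *)

Section finite_fibers.
Context {R : realType}.
Local Notation plane := (R * R)%type.
Variables (g1 g2 : plane -> R) (M L : R).
Hypotheses (M0 : 0 < M) (L0 : 0 <= L).
Hypothesis lip1 : forall x y : plane, `|x| <= M -> `|y| <= M -> `|g1 x - g1 y| <= L * `|x - y|.
Hypothesis lip2 : forall x y : plane, `|x| <= M -> `|y| <= M -> `|g2 x - g2 y| <= L * `|x - y|.

(** [[- M, M]] is cut into [n + 1] intervals, so that there are [n + 2] grid coordinates, both ends
    included. By the Lipschitz bounds, [rect] contains the image of all points of the box within
    [mesh n] of the grid point. *)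
Local Definition mesh (n : nat) : R := 2 * M / n.+1%:R.
Local Definition coord n (i : 'I_n.+2) : R := - M + mesh n * i%:R.
Local Definition center n (p : 'I_n.+2 * 'I_n.+2) : plane := (coord p.1, coord p.2).
Local Definition slab n (z : R) : set R := `[z - L * mesh n, z + L * mesh n]%classic.
Local Definition rect n (p : 'I_n.+2 * 'I_n.+2) : set plane :=
  slab n (g1 (center p)) `*` slab n (g2 (center p)).

Local Lemma mesh_gt0 n : 0 < mesh n.
Proof. by rewrite /mesh divr_gt0 ?mulr_gt0. Qed.
Hint Resolve mesh_gt0 : core.

Local Lemma coord_bound n (i : 'I_n.+2) : `|coord i| <= M.
Proof.
rewrite ler_norml /coord; apply/andP; split.
  by rewrite lerDl mulr_ge0 // ltW.
have : mesh n * i%:R <= mesh n * n.+1%:R.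
  by rewrite ler_pM2l ?mesh_gt0 // ler_nat -ltnS.
by rewrite {2}/mesh divfK ?pnatr_eq0 //; lra.
Qed.

Local Lemma center_bound n (p : 'I_n.+2 * 'I_n.+2) : `|center p| <= M.
Proof. by rewrite plane_normE ge_max /center /= !coord_bound. Qed.

Local Lemma coord_near n t : `|t| <= M -> exists i : 'I_n.+2, `|t - coord i| <= mesh n.
Proof.
rewrite ler_norml => /andP[t1 t2].
pose y := (t + M) / mesh n.
have y0 : 0 <= y by rewrite divr_ge0 ?(ltW (mesh_gt0 n)) //; lra.
have yE : y * mesh n = t + M by rewrite divfK // lt0r_neq0.
have yn : (Num.truncn y < n.+2)%N.
  rewrite ltnS truncn_le_nat ltr_pdivrMr //.
  apply: (@le_lt_trans _ _ (n.+1%:R * mesh n)).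
    by rewrite [n.+1%:R * _]mulrC divfK ?pnatr_eq0 //; lra.
  by rewrite ltr_pM2r // ltr_nat.
exists (Ordinal yn); rewrite /coord /=.
have /andP[h1 h2] := truncn_itv y0.
have := ler_wpM2r (ltW (mesh_gt0 n)) h1.
have := ler_wpM2r (ltW (mesh_gt0 n)) (ltW h2).
rewrite yE -natr1 mulrDl mul1r [_ * mesh n]mulrC => k1 k2.
by rewrite ler_norml; apply/andP; split; lra.
Qed.

Local Lemma center_near n (x : plane) : `|x| <= M -> exists p : 'I_n.+2 * 'I_n.+2,
  `|x - center p| <= mesh n.
Proof.
move=> xM.
have [i iP] := @coord_near n _ (le_trans (norm_fst x) xM).
have [j jP] := @coord_near n _ (le_trans (norm_snd x) xM).
by exists (i, j); rewrite plane_normE ge_max /= iP jP.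
Qed.

Local Definition count n (a : plane) : R := \sum_(p : 'I_n.+2 * 'I_n.+2) \1_(rect p) a.

Local Definition fiber (a : plane) : set plane :=
  [set x | [/\ `|x| <= M, g1 x = a.1 & g2 x = a.2]].

Local Lemma seq_near (T : eqType) (s : seq T) (P : T -> nat -> Prop) :
  (forall x, x \in s -> \forall n \near \oo, P x n) ->
  \forall n \near \oo, forall x, x \in s -> P x n.
Proof.
elim: s => [|x s IH] sP; first exact: nearW.
have Px := sP _ (mem_head _ _).
have Ps := IH (fun y ys => sP y (mem_behead (s := x :: s) ys)).
by near=> n => y; rewrite inE => /predU1P[->|ys]; [near: n|exact: (near Ps)].
Unshelve. all: by end_near. Qed.

Local Lemma mesh_small (e : R) : 0 < e -> \forall n \near \oo, mesh n < e.
Proof.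
move=> e0; exists (Num.truncn (2 * M / e)) => // n /= en.
rewrite /mesh ltr_pdivrMr // [e * _]mulrC -ltr_pdivrMr //.
by rewrite (lt_le_trans (truncnS_gt _)) // ler_nat ltnS.
Qed.

(** Finitely many points of the fiber are eventually more than [2 * mesh n] apart. They are then
    close to distinct grid points, and the rectangle of each of these contains [a]. *)
Local Lemma count_infinite a (K : nat) : infinite_set (fiber a) ->
  \forall n \near \oo, K%:R <= count n a.
Proof.
move=> /(infinite_set_fset K)[B Bfib KB].
have : \forall n \near \oo, forall x : plane, x \in B -> forall y : plane, y \in B ->
    x = y \/ 2 * mesh n < `|x - y|.
  apply: seq_near => x xB; apply: seq_near => y yB.
  have [->|xy] := eqVneq x y; first by apply: nearW; left.
  have xy0 : 0 < `|x - y| / 2 by rewrite divr_gt0 // normr_gt0 subr_eq0.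
  by apply: filterS (mesh_small xy0) => n h; right; lra.
apply: filterS => n sep.
have cellP (x : plane) : exists p : 'I_n.+2 * 'I_n.+2, `|x| <= M -> `|x - center p| <= mesh n.
  have [xM|] := boolP (`|x| <= M); last by exists (ord0, ord0).
  by have [p] := @center_near n _ xM; exists p.
have [cell {}cellP] : exists cell : plane -> 'I_n.+2 * 'I_n.+2,
    forall x : plane, `|x| <= M -> `|x - center (cell x)| <= mesh n.
  by have [cell] := choice cellP; exists cell.
have cell_inj : {in B &, injective cell}.
  move=> x y xB yB exy; case: (sep _ xB _ yB) => // h; exfalso.
  have [xM _ _] := Bfib _ xB; have [yM _ _] := Bfib _ yB.
  have := cellP _ xM; have := cellP _ yM; rewrite exy => hy hx.
  have := @ler_distD R plane (center (cell y)) x y; rewrite (distrC (center (cell y)) y); lra.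
have sub p : p \in [seq cell x | x <- B] -> rect p a.
  move=> /mapP[x xB ->].
  have [xM xa1 xa2] := Bfib _ xB; have xc := cellP _ xM.
  have Lx : L * `|x - center (cell x)| <= L * mesh n by rewrite ler_wpM2l.
  split.
    rewrite /slab /= in_itv /= -ler_distl -xa1.
    by apply: le_trans Lx; apply: lip1 => //; exact: center_bound.
  rewrite /slab /= in_itv /= -ler_distl -xa2.
  by apply: le_trans Lx; apply: lip2 => //; exact: center_bound.
have -> : count n a = #|[pred p : 'I_n.+2 * 'I_n.+2 | a \in rect p]|%:R.
  rewrite /count -sum1_card natr_sum [RHS]big_mkcond /=; apply: eq_bigr => p _.
  by rewrite indicE !inE; case: ifP.
rewrite ler_nat (leq_trans KB) // -(size_map cell) cardE.
apply: uniq_leq_size; first by rewrite map_inj_in_uniq // fset_uniq.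
by move=> p /sub rpa; rewrite mem_enum inE.
Qed.

(* The image of each cell of the grid lies in a rectangle, and these rectangles
   have bounded total area. By Fatou's lemma, for some [a] the number of
   rectangles containing [a] does not tend to infinity, whereas it does as soon
   as the fiber of [a] is infinite. *)
Lemma finite_fiber (e : R) : 0 < e -> exists a : plane,
  [/\ `|a.1| <= e, `|a.2| <= e &
    finite_set [set x : plane | [/\ `|x| <= M, g1 x = a.1 & g2 x = a.2]]].
Proof.
move=> e0; apply: contrapT => none.
pose mu := (@lebesgue_measure R \x @lebesgue_measure R)%E.
pose T := (measurableTypeR R * measurableTypeR R)%type.
pose A : set T :=
  `[- e, e]%classic `*` `[- e, e]%classic.
have mI (x y : R) : measurable (`[x, y]%classic : set (measurableTypeR R)).
  exact: (measurable_itv `[x, y]).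
have mA : measurable A by apply: measurableX; exact: mI.
have mR n (p : 'I_n.+2 * 'I_n.+2) :
    measurable (rect p : set (measurableTypeR R * measurableTypeR R)).
  by apply: measurableX; exact: mI.
pose h n (a : T) : \bar R :=
  (\sum_(p <- enum {: 'I_n.+2 * 'I_n.+2}) (\1_(rect p) a)%:E)%E.
have hE n a : h n a = (count n a)%:E.
  by rewrite /h sumEFin /count big_enum.
have muI (x y : R) : x <= y -> lebesgue_measure (`[x, y]%classic : set R) = (y - x)%:E.
  move=> xy; rewrite lebesgue_measure_itv /= lte_fin.
  case: ltP => // yx; have -> : x = y by apply/eqP; rewrite eq_le xy yx.
  by rewrite subrr.
have muX (x y z t : R) : x <= y -> z <= t ->
    mu (`[x, y]%classic `*` `[z, t]%classic) = ((y - x) * (t - z))%:E.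
  move=> xy zt.
  transitivity (lebesgue_measure (`[x, y]%classic : set R) *
                lebesgue_measure (`[z, t]%classic : set R))%E.
    by apply: product_measure1E; exact: mI.
  by rewrite (muI _ _ xy) (muI _ _ zt) -EFinM.
have muA : mu A = ((2 * e) * (2 * e))%:E.
  rewrite muX; first by congr EFin; ring.
  lra.
  lra.
have muR n p : mu (@rect n p) = ((2 * (L * mesh n)) * (2 * (L * mesh n)))%:E.
  have l0 : 0 <= L * mesh n by rewrite mulr_ge0 // ltW.
  rewrite muX; first by congr EFin; ring.
  lra.
  lra.
have mind n p : measurable_fun A (EFin \o (\1_(@rect n p) : T -> R)).
  by apply/measurable_EFinP; apply: measurable_indic; exact: mR.
have mh n : measurable_fun A (h n) by apply: emeasurable_sum => p; exact: mind.
have h0 n a : (A a -> 0 <= h n a)%E.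
  by move=> _; rewrite /h; apply: sume_ge0 => p _; rewrite lee_fin.
have hy a : A a -> limn_einf (h ^~ a) = +oo%E.
  move=> [a1 a2].
  have inf_a : infinite_set (fiber a).
    move=> fin_a; apply: none; exists a; split=> //; rewrite ler_norml.
      by move: a1; rewrite /= in_itv.
    by move: a2; rewrite /= in_itv.
  have hcvg : (fun n => h n a) @ \oo --> +oo%E.
    apply/cvgeyPge => K; near=> n; rewrite hE lee_fin.
    apply: (@le_trans _ _ (Num.truncn `|K|).+1%:R).
      by rewrite (le_trans (ler_norm _)) // ltW // truncnS_gt.
    near: n; exact: count_infinite.
  by have [-> _] := cvg_limn_einf_sup hcvg.
(* There are [(n + 2)^2] rectangles of area [(4 L M / (n + 1))^2], and [(n + 2) / (n + 1) <= 2]. *)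
pose C : R := 64 * (L * M) * (L * M).
have int_h n : (\int[mu]_(a in A) h n a <= C%:E)%E.
  rewrite /h ge0_integral_sum //; last exact: mind.
  apply: (@le_trans _ _ (\sum_(p <- enum {: 'I_n.+2 * 'I_n.+2})
      ((2 * (L * mesh n)) * (2 * (L * mesh n)))%:E)%E).
    apply: lee_sum => p _; rewrite integral_indic // -(muR n p).
    by apply: le_measure; rewrite ?inE //; exact: measurableI.
  rewrite sumEFin lee_fin big_enum sumr_const card_prod card_ord.
  rewrite -[leLHS]mulr_natl natrM /C /mesh.
  set N := n.+1%:R; have N1 : 1 <= N by rewrite /N ler1n.
  have -> : n.+2%:R = N + 1 :> R by rewrite /N natr1.
  have N0 : N != 0 by rewrite lt0r_neq0 // (lt_le_trans ltr01).
  have -> : (N + 1) * (N + 1) * (2 * (L * (2 * M / N)) * (2 * (L * (2 * M / N)))) =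
     16 * (L * M) * (L * M) * ((N + 1) / N * ((N + 1) / N)) by field.
  have q : (N + 1) / N <= 2 by rewrite ler_pdivrMr; lra.
  have q0 : 0 <= (N + 1) / N by rewrite divr_ge0; lra.
  have qq : (N + 1) / N * ((N + 1) / N) <= 2 * 2 by rewrite ler_pM.
  have LM : 0 <= 16 * (L * M) * (L * M) by rewrite -mulrA mulr_ge0 // -expr2 sqr_ge0.
  apply: le_trans (ler_wpM2l LM qq) _.
  by rewrite le_eqVlt; apply/orP; left; apply/eqP; ring.
have := @fatou _ _ _ mu A mA h mh h0.
rewrite (eq_integral (cst +oo%E)); last by move=> a; rewrite inE => /hy.
rewrite integral_cst // [X in (+oo * X)%E](_ : _ = (2 * e * (2 * e))%:E).
  rewrite gt0_mulye; last by rewrite lte_fin !mulr_gt0.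
  rewrite leye_eq => /eqP lim_int.
  have : (limn_einf (fun n => \int[mu]_(a in A) h n a) <= C%:E)%E.
    rewrite limn_einf_lim; apply: lime_le; first exact: is_cvg_einfs.
    apply: nearW => n; apply: ge_ereal_inf.
    by exists (\int[mu]_(a in A) h n a)%E => //; exists n => /=.
  by rewrite lim_int leye_eq.
exact: muA.
Unshelve. all: by end_near. Qed.

End finite_fibers.

(** * The limit of gamma *)

Section gamma_limit.
Context {R : realType}.
Local Notation plane := (R * R)%type.
Implicit Types (f g F G : plane -> R) (c : R -> plane) (lam mu : nat -> R -> plane).

Lemma counting_le (T : choiceType) (A B : set T) :
  A `<=` B -> (counting A <= counting B :> \bar R)%E.
Proof.
move=> AB; rewrite /counting; case: asboolP => [fA|nfA]; case: asboolP => [fB|nfB].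
- rewrite lee_fin ler_nat; apply: fsubset_leq_card.
  by rewrite -fset_set_sub.
- by rewrite leey.
- by case: nfA; exact: sub_finite_set AB fB.
- by [].
Qed.

Lemma gamma_le f c c' : smooth f -> simple_closed_curve c -> simple_closed_curve c' ->
  generic f c -> generic f c' -> crit f `<=` interior_of c ->
  closure (interior_of c) `<=` interior_of c' -> (gamma f c' <= gamma f c)%E.
Proof.
move=> sf scc scc' gen gen' cf cc'.
apply: le_ereal_inf_tmp => _ [F extF <-].
have [G [sG Gout Gin]] := ribbon_glue sf scc extF.
apply: (@le_trans _ _ (counting (closure (interior_of c') `&` crit G))).
  apply: ereal_inf_lbound; exists G => //.
  apply: extends_ribbon_near => // t; apply: Gout => /(@subset_closure _ _ _)/cc'[+ _].
  by apply; exists t.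
apply: counting_le => x [_ cG].
have [ix|nix] := pselect (interior_of c x).
  by split; [exact: subset_closure|exact: Gin].
by case: (nix); apply/cf/(near_eq_crit (Gout _ nix)).
Qed.

(** The perturbed function has a finite count, so some count is a natural number; the least such
    count is the infimum. *)
Lemma gamma_nat f c : smooth f -> simple_closed_curve c -> generic f c ->
  exists n : nat, gamma f c = (n%:R)%:E.
Proof.
move=> sf scc gen.
have [r [e [r0 e0 pert]]] := ribbon_perturb sf scc gen.
have M0 : 0 < r + 1 by rewrite ltr_wpDl.
have [C1 C10 lip1] := lipschitz_box (r + 1) (smooth_derive ((1, 0) : plane) sf).
have [C2 C20 lip2] := lipschitz_box (r + 1) (smooth_derive ((0, 1) : plane) sf).
have [|||a [a1 a2 fina]] := @finite_fiber R ('D_(1, 0) f) ('D_(0, 1) f)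
    (r + 1) (C1 + C2) M0 _ _ _ _ e0.
- exact: addr_ge0.
- move=> x y xM yM; apply: le_trans (lip1 _ _ xM yM) _.
  by rewrite ler_wpM2r // lerDl.
- move=> x y xM yM; apply: le_trans (lip2 _ _ xM yM) _.
  by rewrite ler_wpM2r // lerDr.
have [F extF critF] := pert _ _ a1 a2.
have finF : finite_set (closure (interior_of c) `&` crit F).
  apply: sub_finite_set fina => x /critF[xr D1 D2]; split=> //.
  by rewrite (le_trans xr) // lerDl.
pose S : set (\bar R) := [set counting (closure (interior_of c) `&` crit F)
                         | F in [set F | extends_ribbon f c F]].
have Sk : exists k : nat, `[< S (k%:R)%:E >].
  exists #|` fset_set (closure (interior_of c) `&` crit F)|; apply/asboolP.
  by exists F => //; rewrite /counting asboolT.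
exists (ex_minn Sk); case: ex_minnP => n /asboolP Sn nmin.
apply/eqP; rewrite eq_le; apply/andP; split; first exact: ereal_inf_lbound.
apply: le_ereal_inf_tmp => y Sy.
have : S y by [].
case: Sy => G extG <-; rewrite /counting; case: asboolP => finG Sy; last exact: leey.
by rewrite lee_fin ler_nat; apply: nmin; apply/asboolP.
Qed.

(** [disk] takes the square of the radius, and the sup-norm box of radius [r] lies in the disk of
    parameter [2 * r ^+ 2]. *)
Lemma exhausting_box f lam (r : R) : exhausting f lam ->
  \forall i \near \oo, forall x : plane, `|x| <= r -> interior_of (lam i) x.
Proof.
move=> [_ _ _ /cvgryPgt/(_ (2 * r ^+ 2)) + _]; apply: filterS => i dist x xr.
have [|s disks rs] := sup_gt _ dist.
  (* The disk of parameter [-1] is empty, which shows that the set under the supremum is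
     nonempty. *)
  exists (-1) => x0; rewrite /disk /= => x00.
  by have := addr_ge0 (sqr_ge0 x0.1) (sqr_ge0 x0.2); lra.
apply: disks; rewrite /disk /=.
have r0 : 0 <= r by exact: le_trans xr.
have sq (t : R) : `|t| <= `|x| -> t ^+ 2 <= r ^+ 2.
  move=> tx; rewrite -(real_normK (num_real t)) lerXn2r ?nnegrE //.
  exact: le_trans xr.
have := sq _ (norm_fst x); have := sq _ (norm_snd x); lra.
Qed.

Lemma gamma_tail_le f lam mu i : smooth f -> exhausting f lam -> exhausting f mu ->
  crit f `<=` interior_of (lam i) ->
  \forall j \near \oo, (gamma f (mu j) <= gamma f (lam i))%E.
Proof.
move=> sf el em cf; have [scl _ _ _ gl] := el; have [scm _ _ _ gm] := em.
have [r r0 rP] := interior_bounded (scl i).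
apply: filterS (exhausting_box r em) => j rj.
by apply: gamma_le => // x /rP/rj.
Qed.

(** The number [n] is the least value of [gamma] on the curves of [lam] that enclose the critical
    set, chosen before [mu]. Far out, a curve of [mu] encloses a curve of [lam] attaining [n], and
    is itself enclosed by another curve of [lam], whose value is at least [n]. *)
Lemma gamma_eventually f lam : smooth f -> bounded_set (crit f) -> exhausting f lam ->
  exists n : nat, forall mu, exhausting f mu ->
    \forall j \near \oo, gamma f (mu j) = (n%:R)%:E.
Proof.
move=> sf [B [_ bB]] el.
have inside mu (em : exhausting f mu) :
    \forall i \near \oo, crit f `<=` interior_of (mu i).
  apply: filterS (exhausting_box (B + 1) em) => i h x cx.
  by apply/h/(bB (B + 1)) => //; rewrite ltrDl.
have [scl _ _ _ gl] := el.
have Pk : exists k : nat, `[< exists2 i, crit f `<=` interior_of (lam i) &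
    gamma f (lam i) = (k%:R)%:E >].
  have [i ci] := filter_ex (inside _ el).
  have [k kE] := gamma_nat sf (scl i) (gl i).
  by exists k; apply/asboolP; exists i.
exists (ex_minn Pk); case: ex_minnP => n /asboolP[i0 ci0 gi0] nmin mu em.
near=> j.
have cj : crit f `<=` interior_of (mu j) by near: j; exact: (inside _ em).
apply/eqP; rewrite eq_le; apply/andP; split.
  by rewrite -gi0; near: j; exact: gamma_tail_le.
have [i [ci ij]] : exists i, crit f `<=` interior_of (lam i) /\
    (gamma f (lam i) <= gamma f (mu j))%E.
  apply: (@filter_ex _ \oo).
  by apply: filterI; [exact: (inside _ el)|exact: gamma_tail_le].
apply: le_trans ij; have [k kE] := gamma_nat sf (scl i) (gl i).
by rewrite kE lee_fin ler_nat; apply: nmin; apply/asboolP; exists i.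
Unshelve. all: by end_near. Qed.

Lemma near_curve_eq f g c (r : R) : (forall x : plane, r < `|x| -> f x = g x) ->
  (forall x : plane, `|x| <= r -> interior_of c x) ->
  forall t, \forall y \near c t, f y = g y.
Proof.
move=> fg rc t.
have ct : r < `|c t|.
  by rewrite ltNge; apply/negP => /rc[+ _]; apply; exists t.
have ny : \forall y \near c t, r < `|y|.
  exact: (@norm_continuous R plane (c t) _ (lt_nbhsr ct)).
by apply: filterS ny => y; exact: fg.
Qed.

Lemma near_curve_ribbon f g c : (forall t, \forall y \near c t, f y = g y) ->
  generic f c -> generic g c /\ gamma f c = gamma g c.
Proof.
move=> fg gen.
have fgc : f \o c = g \o c.
  by apply/funext => t; exact: (nbhs_singleton (fg t)).
have nodeE t : node f c t = node g c t by rewrite /node fgc.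
have Dfg t v : 'D_v f (c t) = 'D_v g (c t) by exact: near_eq_derive.
have fgt t : f (c t) = g (c t) by exact: (nbhs_singleton (fg t)).
split.
  have [disj nondeg inj] := gen; split.
  - apply/seteqP; split=> // x [[t _ <-] cg].
    suff : (range c `&` crit f) (c t) by rewrite disj.
    by split; [exists t|move=> v; rewrite Dfg].
  - by move=> t; rewrite -nodeE -fgc; exact: nondeg.
  - by move=> s t; rewrite -!nodeE -!fgt; exact: inj.
congr (ereal_inf (image _ _)); apply/seteqP; split=> F [sF Ff Fn]; split=> //.
- by move=> t; rewrite Ff fgt.
- by move=> t n; rewrite -nodeE -Dfg; exact: Fn.
- by move=> t; rewrite Ff fgt.
- by move=> t n; rewrite nodeE Dfg; exact: Fn.
Qed.

(** The first curves may meet the region where [f] and [g] differ, and then need not be generic for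
    [g]; the tail encloses this region. *)
Lemma exhausting_shift f g lam (r : R) : (forall x : plane, r < `|x| -> f x = g x) ->
  exhausting f lam -> exists N : nat, exhausting g (fun i => lam (i + N)%N) /\
    forall i, gamma f (lam (i + N)%N) = gamma g (lam (i + N)%N).
Proof.
move=> fg el; have [N _ NP] := exhausting_box r el; exists N.
have [scl precl orl distl genl] := el.
have key i := near_curve_ribbon (near_curve_eq fg (NP (i + N)%N (leq_addl _ _)))
  (genl (i + N)%N).
split=> [|i]; last by have [] := key i.
split.
- by move=> i; exact: scl.
- by move=> i; exact: precl.
- by move=> i; exact: orl.
- by rewrite (cvg_shiftn N (fun i => dist_curve (lam i))).
- by move=> i; have [] := key i.
Qed.

End gamma_limit.

Unset Implicit Arguments.

Theorem theorem19p3 (R : realType) (f : R * R -> R) (lam : nat -> R -> R * R)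
    (smooth_f : smooth f) (crit_f : bounded_set (crit f))
    (exh_lam : exhausting f lam) :
  exists n : nat,
    gamma_infty_is f n /\
    forall h : R * (R * R) -> R, compact_homotopy f h ->
      gamma_infty_is (fun x => h (1, x)) n.
Proof.
have [n gn] := gamma_eventually smooth_f crit_f exh_lam.
have lim_of g mu : (\forall j \near \oo, gamma g (mu j) = (n%:R)%:E) ->
    gamma g (mu i) @[i --> \oo] --> (n%:R : R)%:E.
  exact: cvg_near_cst.
exists n; split.
  split; first by exists lam.
  by move=> mu /gn; exact: lim_of.
move=> h [_ _ [W0 [[r [_ rP]] h1]]].
have fg x : r + 1 < `|x| -> f x = h (1, x).
  move=> rx; rewrite h1 ?in_itv /= ?ler01 ?lexx // => /rP.
  by move=> /(_ (r + 1)); rewrite ltrDl ltr01 => /(_ isT) /=; rewrite leNgt rx.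
split.
  by have [N [eN _]] := exhausting_shift fg exh_lam; exists (fun i => lam (i + N)%N).
move=> mu em; apply: lim_of.
(* Conversely, a sequence exhausting for the end of the homotopy has a tail that is exhausting for
   [f], where the value [n] is known. *)
have gf x : r + 1 < `|x| -> h (1, x) = f x by move=> rx; rewrite fg.
have [N [eN gN]] := exhausting_shift gf em.
have [K _ KP] := gn _ eN.
exists (K + N)%N => // j /= KNj.
have Nj : (N <= j)%N by rewrite (leq_trans _ KNj) // leq_addl.
by rewrite -(subnK Nj) gN; apply: KP; rewrite /= leq_subRL // addnC.
Qed.
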